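(* Let $W$ be a standard one-dimensional Brownian motion, let $T>0$, and let $f:\mathbb{R}\to\mathbb{R}$ be bounded. For $\varepsilon>0$ let $Q_\varepsilon(t)=[f(\varepsilon W),\varepsilon W](t)$, $t\in[0,T]$. Suppose that ${\rm osc}_f(\delta)\le C_f\delta^\alpha$ for some $\alpha\in(0,1)$, some $C_f>0$ and all sufficiently small $\delta>0$. Then for every $\delta>0$, $\gamma\in(0,\alpha)$ and $\mu\in(\gamma,\alpha)$ there are constants $\varepsilon_{\delta,\mu}>0$ and $C_{\delta,\mu}>0$ such that \[ \mathsf{P}\Big\{\varepsilon^{-(1+\gamma)}\sup_{t\le T}|Q_\varepsilon(t)|>\delta\Big\}\le C_{\delta,\mu}\,\varepsilon^{2(\alpha-\mu)/(1-\alpha)},\qquad \varepsilon\in(0,\varepsilon_{\delta,\mu}). \] In particular, for any $\gamma\in(0,\alpha)$, $\varepsilon^{-(1+\gamma)}\sup_{t\le T}|Q_\varepsilon(t)|\to 0$ in probability as $\varepsilon\to0$.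
   Context: The modulus of continuity of $f$ is ${\rm osc}_f(\delta)=\sup_{|t-s|<\delta}|f(s)-f(t)|$ for $\delta>0$. The quadratic covariation $[X,Y](t)$ of two processes is the limit in probability, as the mesh of partitions $0=u_0<\dots<u_m=t$ tends to $0$, of $\sum_{k}(X(u_{k+1})-X(u_k))(Y(u_{k+1})-Y(u_k))$. *)

(* Defs.v *)
From HB Require Import structures.
From mathcomp Require Import all_boot all_order all_algebra.
From mathcomp Require Import all_classical all_reals all_analysis.
Set Implicit Arguments. Unset Strict Implicit. Unset Printing Implicit Defensive.
Import Order.TTheory GRing.Theory Num.Theory.
Import numFieldNormedType.Exports.
Local Open Scope classical_set_scope.
Local Open Scope ring_scope.

Section Defs.
Context {R : realType} {d : measure_display} {Omega : measurableType d}.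
Variable P : probability Omega R.

Definition is_brownian_motion (W : Omega -> R -> R) : Prop :=
  [/\ (forall t, 0 <= t -> measurable_fun setT (fun w => W w t)),
      (forall w, W w 0 = 0),
      (forall w, {within [set t | 0 <= t], continuous (W w)}),
      (* Gaussian increments: W t - W s ~ N(0, t - s) (std. dev. sqrt(t-s)) *)
      (forall s t, 0 <= s -> s < t -> forall B : set R, measurable B ->
         P [set w | B (W w t - W w s)] = normal_prob 0 (Num.sqrt (t - s)) B) &
      (forall (n : nat) (u : nat -> R), 0 <= u 0%N ->
         (forall k, (k < n)%N -> u k < u k.+1) ->
         forall B : nat -> set R, (forall k, measurable (B k)) ->
         P (\bigcap_(k in [set k | (k < n)%N]) [set w | B k (W w (u k.+1) - W w (u k))])
         = (\prod_(k < n) P [set w | B k (W w (u k.+1) - W w (u k))%R])%E)].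

Definition partition_of (t : R) (m : nat) (u : nat -> R) : Prop :=
  [/\ u 0%N = 0, u m = t & forall k, (k < m)%N -> u k < u k.+1].

Definition mesh (m : nat) (u : nat -> R) : R :=
  \big[Num.max/0]_(k < m) (u k.+1 - u k).

Definition cov_sum (X Y : Omega -> R -> R) (m : nat) (u : nat -> R) (w : Omega) : R :=
  \sum_(k < m) (X w (u k.+1) - X w (u k)) * (Y w (u k.+1) - Y w (u k)).

Definition is_qcov_at (X Y : Omega -> R -> R) (t : R) (Z : Omega -> R) : Prop :=
  forall eta e : R, 0 < eta -> 0 < e ->
    exists dd : R, 0 < dd /\
      forall (m : nat) (u : nat -> R), partition_of t m u -> mesh m u < dd ->
        (P [set w | (eta < `|cov_sum X Y m u w - Z w|)%R] <= e%:E)%E.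
End Defs.

Definition osc {R : realType} (f : R -> R) (delta : R) : R :=
  sup [set r | exists s t : R, `|t - s| < delta /\ r = `|f s - f t|].

(* Main.v *)
(* A bounded function with the given modulus of continuity is Hoelder, so for
   every h > 0 it splits as f = l + g with l Lipschitz of constant C h^(alpha-1)
   and |g| <= C h^alpha (inf-convolution).  On a uniform grid of step T/n with
   Brownian increments X_k and S_k = W(kT/n), the l-part of the covariation sum is
   at most C h^(alpha-1) eps^2 sum X_k^2, and sum X_k^2 concentrates below 7T by
   Chebyshev.  The g-part is eps times
     sum g(eps S_{k+1}) (X_k - S_{k+1}/(k+1)) + sum g(eps S_{k+1}) S_{k+1}/(k+1)
       - sum g(eps S_k) X_k.
   The last sum is a martingale (X_k is symmetric given the past), the first is a
   reversed martingale (X_0, ..., X_k are exchangeable given S_{k+1} and the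
   future), and Kolmogorov's maximal inequality bounds both; the middle one has
   second moment at most 24 T sup|g|^2.  Letting n go to infinity along dyadic
   refinements gives P(sup |Q| > 2 lam) <= 2304 T eps^2 C^2 h^(2 alpha) / lam^2,
   and h^(1-alpha) of order eps^(1-gamma) yields the rate
   eps^(2(alpha-gamma)/(1-alpha)). *)
Require Import Defs.
From HB Require Import structures.
From mathcomp Require Import all_boot all_order all_algebra.
From mathcomp Require Import all_classical all_reals all_analysis.
From mathcomp Require Import measurable_realfun lra ring.
Set Implicit Arguments.
Unset Strict Implicit.
Unset Printing Implicit Defensive.
Import Order.TTheory GRing.Theory Num.Theory.
Import numFieldNormedType.Exports.
Local Open Scope classical_set_scope.
Local Open Scope ring_scope.

(** * Expectations of nonnegative functions and Chebyshev's inequality *)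

Section nonneg_expectation.
Context (R : realType) (d : measure_display) (T : measurableType d).
Variable P : probability T R.
Implicit Types X Y : T -> R.
Local Open Scope ereal_scope.

Lemma ge0_expectation_le X Y : measurable_fun setT X -> measurable_fun setT Y ->
  (forall w, 0 <= X w)%R -> (forall w, X w <= Y w)%R -> 'E_P[X] <= 'E_P[Y].
Proof.
move=> mX mY X0 XY; rewrite unlock; apply: ge0_le_integral => //=.
- by move=> w _; rewrite lee_fin.
- exact/measurable_EFinP.
- exact/measurable_EFinP.
- by move=> w _; rewrite lee_fin.
Qed.

Lemma ge0_expectationD X Y : measurable_fun setT X -> measurable_fun setT Y ->
  (forall w, 0 <= X w)%R -> (forall w, 0 <= Y w)%R ->
  'E_P[fun w => (X w + Y w)%R] = 'E_P[X] + 'E_P[Y].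
Proof.
move=> mX mY X0 Y0; rewrite unlock.
under eq_integral do rewrite EFinD.
rewrite ge0_integralD//.
- by move=> w _; rewrite lee_fin.
- exact/measurable_EFinP.
- by move=> w _; rewrite lee_fin.
- exact/measurable_EFinP.
Qed.

Lemma ge0_expectationZ (k : R) X : measurable_fun setT X ->
  (forall w, 0 <= X w)%R -> (0 <= k)%R ->
  'E_P[fun w => (k * X w)%R] = k%:E * 'E_P[X].
Proof.
move=> mX X0 k0; rewrite unlock.
under eq_integral do rewrite EFinM.
rewrite ge0_integralZl_EFin//.
- by move=> w _; rewrite lee_fin.
- exact/measurable_EFinP.
Qed.

Lemma ge0_expectation_sum (n : nat) (X : nat -> T -> R) :
  (forall k, (k < n)%N -> measurable_fun setT (X k)) ->
  (forall k w, (k < n)%N -> 0 <= X k w)%R ->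
  'E_P[fun w => (\sum_(k < n) X k w)%R] = \sum_(k < n) 'E_P[X k].
Proof.
elim: n => [|n IHn] mX X0.
  under eq_fun do rewrite big_ord0.
  by rewrite big_ord0; exact: (expectation_cst P 0).
have mX' k : (k < n)%N -> measurable_fun setT (X k) by move=> kn; exact/mX/ltnW.
have X0' k w : (k < n)%N -> (0 <= X k w)%R by move=> kn; exact/X0/ltnW.
under eq_fun do rewrite big_ord_recr/=.
rewrite big_ord_recr/= ge0_expectationD ?IHn//.
- by apply: measurable_sum => k; exact: mX'.
- exact: mX.
- by move=> w; apply: sumr_ge0 => k _; exact: X0'.
- by move=> w; exact: X0.
Qed.

Lemma measurable_gt_norm (a : R) X : measurable_fun setT X ->
  measurable [set w | (a < `|X w|)%R].
Proof.
move=> mX; have m : measurable_fun setT (fun w => (a < `|X w|)%R).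
  by apply: measurable_fun_ltr => //; exact: measurableT_comp.
rewrite (_ : [set w | _] = [set: T] `&` (fun w => a < `|X w|)%R @^-1` [set true]).
  exact: m.
by rewrite setTI; apply/seteqP; split => w.
Qed.

(** Chebyshev: the indicator of the event is pointwise at most [X ^+ 2 / a ^+ 2]. The second moment
    may be infinite. *)
Lemma probability_gt_sqr (a : R) X : (0 < a)%R -> measurable_fun setT X ->
  P [set w | (a < `|X w|)%R] <= (a ^- 2)%:E * 'E_P[fun w => (X w ^+ 2)%R].
Proof.
move=> a0 mX.
have mA := measurable_gt_norm a mX.
rewrite -(expectation_indic P mA) -ge0_expectationZ ?invr_ge0 ?exprn_ge0 ?(ltW a0)//; last 2 first.
- exact: measurable_funX.
- by move=> w; exact: sqr_ge0.
apply: ge0_expectation_le => //.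
- by apply: measurable_funM => //; exact: measurable_funX.
- move=> w; rewrite indicE; have [|_] := boolP (w \in _); last first.
    by rewrite mulr_ge0 ?sqr_ge0// invr_ge0 exprn_ge0// ltW.
  rewrite inE/= => aw; rewrite mulrC ler_pdivlMr ?exprn_gt0// mul1r.
  by rewrite -[leRHS]real_normK ?num_real// ler_sqr ?nnegrE ?(ltW a0)// ltW.
Qed.

End nonneg_expectation.

(** * Laws of finite families and their invariance under sign flips and transpositions *)

Section cylinder_law.
Context (R : realType) (d : measure_display) (T : measurableType d).
Variable P : probability T R.

(* Only the first [n] coordinates are measurable. *)
Definition cylinders (n : nat) : set (set (nat -> R)) :=
  [set A | exists2 B : nat -> set R, (forall k, measurable (B k)) &
     A = [set x | forall k, (k < n)%N -> B k (x k)]].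

Definition seqspace (n : nat) := g_sigma_algebraType (cylinders n).

Lemma measurable_coord (n k : nat) : (k < n)%N ->
  measurable_fun [set: seqspace n] (fun x : seqspace n => x k : R).
Proof.
move=> kn _ B mB; rewrite setTI; apply: sub_sigma_algebra.
exists (fun i => if i == k then B else setT).
  by move=> i; case: ifP.
apply/seteqP; split => x /=.
  by move=> Bx i _; case: eqP => // ->.
by move=> /(_ k kn); rewrite eqxx.
Qed.

Lemma measurable_to_seqspace (n : nat) (X : nat -> T -> R) :
  (forall k, (k < n)%N -> measurable_fun setT (X k)) ->
  measurable_fun setT (fun w => (X ^~ w) : seqspace n).
Proof.
move=> mX; apply: (@measurability _ _ _ (seqspace n) setT (fun w => X ^~ w) (cylinders n)) => // _ [_ [B mB ->] <-].
rewrite setTI (_ : _ @^-1` _ =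
    \bigcap_(k in [set k | (k < n)%N]) (X k @^-1` B k)); last first.
  by apply/seteqP; split => w /=.
apply: bigcap_measurableType => k kn.
by rewrite -[X in measurable X]setTI; exact: mX.
Qed.

Lemma setI_closed_cylinders n : setI_closed (cylinders n).
Proof.
move=> _ _ [B mB ->] [C mC ->]; exists (fun k => B k `&` C k).
  by move=> k; exact: measurableI.
apply/seteqP; split => x /=.
  by move=> [Bx Cx] k kn; split; [exact: Bx|exact: Cx].
by move=> BC; split => k /BC[].
Qed.

(** Cylinders are closed under intersection and generate the sigma-algebra, so two laws that agree
    on them are equal; both expectations are integrals of [F] against these laws. *)
Lemma expectation_eq_law (n : nat) (X Y : nat -> T -> R) (F : seqspace n -> R) :
  (forall k, (k < n)%N -> measurable_fun setT (X k)) ->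
  (forall k, (k < n)%N -> measurable_fun setT (Y k)) ->
  (forall B : nat -> set R, (forall k, measurable (B k)) ->
    P (\bigcap_(k in [set k | (k < n)%N]) (X k @^-1` B k)) =
    P (\bigcap_(k in [set k | (k < n)%N]) (Y k @^-1` B k))) ->
  measurable_fun setT F -> (forall x, 0 <= F x) ->
  ('E_P[fun w => F (X ^~ w)] = 'E_P[fun w => F (Y ^~ w)])%E.
Proof.
move=> /measurable_to_seqspace mX /measurable_to_seqspace mY XY mF F0.
rewrite unlock.
have E Z (mZ : measurable_fun setT (fun w => (Z ^~ w) : seqspace n)) :
  (\int[P]_w (F (Z ^~ w))%:E =
   \int[pushforward P (fun w => (Z ^~ w) : seqspace n)]_x (F x)%:E)%E.
  rewrite ge0_integral_pushforward//.
  - exact/measurable_EFinP.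
  - by move=> x _; rewrite lee_fin.
rewrite !E//; apply: eq_measure_integral => A mA _.
pose X' : {mfun T >-> seqspace n} := HB.pack (fun w => (X ^~ w) : seqspace n)
  (isMeasurableFun.Build _ _ _ _ _ mX).
pose Y' : {mfun T >-> seqspace n} := HB.pack (fun w => (Y ^~ w) : seqspace n)
  (isMeasurableFun.Build _ _ _ _ _ mY).
apply: (@g_sigma_algebra_measure_unique _ _ (seqspace n) (cylinders n) _
  (fun=> setT) _ _ (distribution P X') (distribution P Y') _ _ _ A mA).
- exact: sub_sigma_algebra.
- by move=> _; exists (fun=> setT) => //; apply/seteqP; split.
- by apply/seteqP; split => // x _; exists 0%N.
- exact: setI_closed_cylinders.
- move=> _ [B mB ->]; rewrite /distribution /pushforward/=.
  by have := XY B mB.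
- by move=> _; rewrite (le_lt_trans (probability_le1 _ _)) ?ltry.
Qed.

Definition swapn (i k j : nat) : nat :=
  if j == i then k else if j == k then i else j.

Lemma swapnK i k : involutive (swapn i k).
Proof.
move=> j; rewrite /swapn; case: (eqVneq j i) => [->|ji].
  by case: (eqVneq k i) => [->//|ki]; rewrite eqxx.
case: (eqVneq j k) => [->|jk]; first by rewrite eqxx.
by rewrite (negbTE ji) (negbTE jk).
Qed.

Lemma swapn_ltn n i k j : (i < n)%N -> (k < n)%N -> (j < n)%N ->
  (swapn i k j < n)%N.
Proof. by rewrite /swapn; case: ifP => // _; case: ifP. Qed.

Section iid.
Variables (n : nat) (X : nat -> T -> R) (nu : set R -> \bar R).
Hypothesis mX : forall k, (k < n)%N -> measurable_fun setT (X k).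
Hypothesis iidX : forall B : nat -> set R, (forall k, measurable (B k)) ->
  P (\bigcap_(k in [set k | (k < n)%N]) (X k @^-1` B k)) =
  (\prod_(k < n) nu (B k))%E.

(** The flip pulls a box back to the box whose side [k] is reflected, and the symmetry of [nu]
    leaves the product of the side masses unchanged. *)
Lemma expectation_flip (k : nat) (F : seqspace n -> R) : (k < n)%N ->
  (forall B : set R, measurable B -> nu [set x | B (- x)] = nu B) ->
  measurable_fun setT F -> (forall x, 0 <= F x) ->
  ('E_P[fun w => F (X ^~ w)] =
   'E_P[fun w => F (fun i => if i == k then - X i w else X i w)%R])%E.
Proof.
move=> kn nuN mF F0.
apply: (@expectation_eq_law n X (fun i w => if i == k then - X i w else X i w)) => //.
  move=> i ik /=; case: (i == k); last exact: mX.
  by apply: measurable_funN; exact: mX.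
move=> B mB; rewrite iidX//.
pose C i := if i == k then [set x | B i (- x)] else B i.
have mC i : measurable (C i).
  rewrite /C; case: ifP => // _; rewrite -[X in measurable X]setTI.
  exact: oppr_measurable.
rewrite (_ : (\bigcap_(i in [set i | (i < n)%N])
    ((fun w => if i == k then - X i w else X i w) @^-1` B i)) =
    \bigcap_(i in [set i | (i < n)%N]) (X i @^-1` C i)); last first.
  by apply: eq_bigcapr => i _; apply/seteqP; split => w;
    rewrite /C /preimage/=; case: ifP.
rewrite iidX//; apply: eq_bigr => i _; rewrite /C; case: ifP => // _.
by rewrite nuN.
Qed.

(** A transposition only permutes the sides of a box, hence the factors of a commutative product. *)
Lemma expectation_swap (i k : nat) (F : seqspace n -> R) :
  (i < n)%N -> (k < n)%N ->
  measurable_fun setT F -> (forall x, 0 <= F x) ->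
  ('E_P[fun w => F (X ^~ w)] = 'E_P[fun w => F (fun j => X (swapn i k j) w)])%E.
Proof.
move=> lin kn mF F0.
apply: (@expectation_eq_law n X (fun j => X (swapn i k j))) => //.
  by move=> j jn; apply: mX; exact: swapn_ltn.
move=> B mB; rewrite iidX//.
rewrite (_ : (\bigcap_(j in [set j | (j < n)%N]) (X (swapn i k j) @^-1` B j)) =
    \bigcap_(j in [set j | (j < n)%N]) (X j @^-1` B (swapn i k j))); last first.
  apply/seteqP; split => w /= Bw j jn.
    by have := Bw (swapn i k j) (swapn_ltn lin kn jn); rewrite /= swapnK.
  by have := Bw (swapn i k j) (swapn_ltn lin kn jn); rewrite /= swapnK.
rewrite iidX//.
pose h (j : 'I_n) := Ordinal (swapn_ltn lin kn (ltn_ord j)).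
rewrite (reindex_inj (h := h))//.
by move=> a b /(congr1 val)/= /(can_inj (swapnK i k)) /val_inj.
Qed.

End iid.
End cylinder_law.

(** * Partial sums stopped at the first crossing of a level *)

Section stopped.
Context (R : realType).
Implicit Types (lam : R) (u : nat -> R).

(** The partial sums of [u], frozen once they exceed [lam] in absolute value. The final value alone
    then records whether a crossing ever occurred, which turns a maximal inequality into Chebyshev's
    inequality for one variable. *)
Fixpoint stopped lam u (j : nat) : R :=
  if j is j'.+1 then
    if lam < `|stopped lam u j'| then stopped lam u j'
    else stopped lam u j' + u j'
  else 0.

Lemma eq_stopped lam u v j : (forall i, (i < j)%N -> u i = v i) ->
  stopped lam u j = stopped lam v j.
Proof.
elim: j => //= j IHj uv.
by rewrite IHj ?uv// => i ij; rewrite uv// ltnS ltnW.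
Qed.

(** A frozen value stays frozen. If the final value were at most [lam], descending from [n] no
    earlier value could exceed it, so the stopped sums would coincide with the partial sums and none
    of these would cross. *)
Lemma stopped_gt lam u j n : (j <= n)%N ->
  lam < `|\sum_(i < j) u i| -> lam < `|stopped lam u n|.
Proof.
move=> jn lamj; case: (ltP lam) => // lamn.
have le_stopped i : (i <= n)%N -> `|stopped lam u i| <= lam.
  elim: n lamn {jn} => [|n IHn] lamn; first by case: i.
  rewrite leq_eqVlt => /predU1P[->//|]; rewrite ltnS => ni.
  apply: IHn => //; move: lamn => /=.
  by case: (ltP lam `|stopped lam u n|) => // /lt_geF ->.
suff E i : (i <= n)%N -> stopped lam u i = \sum_(k < i) u k.
  by move: lamj; rewrite -E// ltNge le_stopped.
elim: i => [|i IHi] ni; first by rewrite big_ord0.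
by rewrite big_ord_recr/= ltNge le_stopped ?(ltnW ni)//= IHi// ltnW.
Qed.

Lemma measurable_stopped (d : measure_display) (T : measurableType d) lam
    (u : T -> nat -> R) j :
  (forall i, (i < j)%N -> measurable_fun setT (u ^~ i)) ->
  measurable_fun setT (fun x => stopped lam (u x) j).
Proof.
elim: j => [|j IHj] mu /=; first exact: measurable_cst.
have {}IHj : measurable_fun setT (fun x => stopped lam (u x) j).
  by apply: IHj => i ij; apply: mu; exact: ltnW.
apply: measurable_fun_ifT => //.
- by apply: measurable_fun_ltr => //; exact: measurableT_comp.
- by apply: measurable_funD => //; exact: mu.
Qed.

End stopped.

(** * Partial sums and squares of centred terms *)

Section psum.
Context (R : realType).
Implicit Types x y : nat -> R.

Definition psum x (k : nat) : R := \sum_(i < k) x i.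

Lemma eq_psum x y k : (forall i, (i < k)%N -> x i = y i) -> psum x k = psum y k.
Proof. by move=> xy; apply: eq_bigr => i _; exact: xy. Qed.

Lemma psum_swap x i k m : (i < m)%N -> (k < m)%N ->
  psum (fun j => x (swapn i k j)) m = psum x m.
Proof.
move=> im km; pose h (j : 'I_m) := Ordinal (swapn_ltn im km (ltn_ord j)).
rewrite /psum [RHS](reindex_inj (h := h))//.
by move=> a b /(congr1 val)/= /(can_inj (swapnK i k)) /val_inj.
Qed.

Lemma measurable_psum n k : (k <= n)%N ->
  measurable_fun [set: seqspace R n] (fun x : seqspace R n => psum x k).
Proof.
move=> kn; apply: measurable_sum => i.
by apply: measurable_coord; exact: leq_trans kn.
Qed.

(** The deviations from the mean [m] sum to zero, which removes the cross term; the two sides then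
    differ by exactly [k.+1%:R * (b * m) ^+ 2]. *)
Lemma sum_sqr_centered (a b : R) x k :
  \sum_(i < k.+1) (a + b * (x i - psum x k.+1 / k.+1%:R)) ^+ 2 <=
  k.+1%:R * a ^+ 2 + b ^+ 2 * \sum_(i < k.+1) x i ^+ 2.
Proof.
set m := psum x k.+1 / k.+1%:R.
have xm : \sum_(i < k.+1) x i = k.+1%:R * m.
  by rewrite /m mulrCA divff ?mulr1// pnatr_eq0.
rewrite (eq_bigr (fun i : 'I_k.+1 => a ^+ 2 + b ^+ 2 * x i ^+ 2 +
  (2 * a * b - 2 * b ^+ 2 * m) * x i + (b ^+ 2 * m ^+ 2 - 2 * a * b * m))); last first.
  by move=> i _; ring.
rewrite 3!big_split/= !sumr_const !card_ord -!mulr_sumr xm -subr_ge0.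
rewrite -[a ^+ 2 *+ _]mulr_natl -[(_ - _) *+ _]mulr_natl.
set s := \sum_(_ < _) _.
rewrite [leRHS](_ : _ = k.+1%:R * (b * m) ^+ 2); last by ring.
by rewrite mulr_ge0 ?sqr_ge0// ler0n.
Qed.

End psum.

(** * Kolmogorov's maximal inequality for the forward and the reversed martingale *)

Section maximal.
Context (R : realType) (d : measure_display) (T : measurableType d).
Variable P : probability T R.
Local Open Scope ereal_scope.

(** Substitute for conditional expectation: the [G i] will be the images of [F] under symmetries of
    the law, and only their average has to be bounded pointwise. *)
Lemma expectation_le_average (m : nat) (F : T -> R) (G : nat -> T -> R)
    (H : T -> R) :
  (forall i, (i < m.+1)%N -> measurable_fun setT (G i)) ->
  (forall i w, 0 <= G i w)%R ->
  (forall i, (i < m.+1)%N -> 'E_P[F] = 'E_P[G i]) ->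
  measurable_fun setT H -> (forall w, 0 <= H w)%R ->
  (forall w, \sum_(i < m.+1) G i w <= m.+1%:R * H w)%R ->
  'E_P[F] <= 'E_P[H].
Proof.
move=> mG G0 FG mH H0 GH.
rewrite -(@lee_pmul2l _ m.+1%:R%:E) ?lte_fin ?ltr0n//.
rewrite -[leRHS]ge0_expectationZ ?ler0n//.
apply: (@le_trans _ _ 'E_P[fun w => (\sum_(i < m.+1) G i w)%R]).
  rewrite ge0_expectation_sum//.
  rewrite (eq_bigr (fun=> 'E_P[F])); last by move=> i _; rewrite -FG.
  by rewrite sumr_const card_ord mule_natl.
apply: ge0_expectation_le => //.
- by apply: measurable_sum => i; exact: mG.
- by apply: measurable_funM.
- by move=> w; apply: sumr_ge0.
Qed.

(** The stopped sum starts at 0 and its second moment grows by at most [c] per step, so it ends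
    below [n * c]; Chebyshev concludes. *)
Lemma stopped_tail (n : nat) (u : T -> nat -> R) (lam c : R) : (0 < lam)%R ->
  (forall i, (i < n)%N -> measurable_fun setT (u ^~ i)) ->
  (forall j, (j < n)%N -> 'E_P[fun w => (stopped lam (u w) j.+1 ^+ 2)%R] <=
     'E_P[fun w => (stopped lam (u w) j ^+ 2)%R] + c%:E) ->
  P [set w | lam < `|stopped lam (u w) n|]%R <= (n%:R * c / lam ^+ 2)%:E.
Proof.
move=> lam0 mu step.
apply: (le_trans (probability_gt_sqr P lam0 (measurable_stopped lam mu))).
rewrite mulrC EFinM lee_pmul2l// ?lte_fin ?invr_gt0 ?exprn_gt0//.
elim: n {mu} step => [|n IHn] step.
  rewrite mul0r (_ : (fun w => _) = cst 0%R) ?expectation_cst//.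
  by apply/funext => w; rewrite /= expr0n.
apply: (le_trans (step n _)) => //; rewrite -natr1 mulrDl mul1r EFinD leeD2r//.
by apply: IHn => j jn; apply: step; exact: ltnW.
Qed.

Section iid_maximal.
Variables (n : nat) (X : nat -> T -> R) (nu : set R -> \bar R) (v : R).
Hypothesis mX : forall k, (k < n)%N -> measurable_fun setT (X k).
Hypothesis iidX : forall B : nat -> set R, (forall k, measurable (B k)) ->
  P (\bigcap_(k in [set k | (k < n)%N]) (X k @^-1` B k)) =
  (\prod_(k < n) nu (B k))%E.
Hypothesis sqrX : forall k, (k < n)%N -> 'E_P[fun w => (X k w ^+ 2)%R] <= v%:E.
Variables (phi : R -> R) (g lam : R).
Hypothesis mphi : measurable_fun setT phi.
Hypothesis phig : forall x, (`|phi x| <= g)%R.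
Hypothesis lam0 : (0 < lam)%R.

Let sqr_phi x : (phi x ^+ 2 <= g ^+ 2)%R.
Proof.
rewrite -[leLHS]real_normK ?num_real// ler_sqr ?nnegrE//.
exact: le_trans (phig x).
Qed.

Let mcomp (F : seqspace R n -> R) : measurable_fun setT F ->
  measurable_fun setT (fun w => F (X ^~ w)).
Proof. by move=> mF; apply: (measurableT_comp mF); exact: measurable_to_seqspace. Qed.

Definition fwd (x : nat -> R) (k : nat) : R := (phi (psum x k) * x k)%R.

Lemma measurable_fwd k : (k < n)%N ->
  measurable_fun [set: seqspace R n] (fun x => fwd x k).
Proof.
move=> kn; apply: measurable_funM; last exact: measurable_coord.
by apply: measurableT_comp => //; apply: measurable_psum; exact: ltnW.
Qed.

(* Changing the sign of [X j] fixes the past and reverses the next increment,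
   so the cross term of the square averages out without any integrability. *)
Lemma forward_maximal :
  (forall B : set R, measurable B -> nu [set x | B (- x)%R] = nu B) ->
  P [set w | lam < `|stopped lam (fwd (X ^~ w)) n|]%R <=
    (n%:R * (g ^+ 2 * v) / lam ^+ 2)%:E.
Proof.
move=> nuN; apply: stopped_tail => //.
  by move=> i ni; exact: mcomp (measurable_fwd ni).
move=> j jn.
have mst i : (i <= n)%N ->
    measurable_fun [set: seqspace R n] (fun x => stopped lam (fwd x) i).
  by move=> ni; apply: measurable_stopped => k ki;
    apply: measurable_fwd; exact: leq_trans ni.
pose F (x : seqspace R n) := (stopped lam (fwd x) j.+1 ^+ 2)%R.
pose flip (x : seqspace R n) : seqspace R n :=
  fun i => if i == j then (- x i)%R else x i.
(* The average runs over two terms, the identity and the flip. *)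
pose G i w := if i == 0%N then F (X ^~ w) else F (flip (X ^~ w)).
have mF : measurable_fun setT F by apply: measurable_funX; exact: mst.
have mflip : measurable_fun setT (fun w => flip (X ^~ w)).
  apply: measurable_to_seqspace => i ni.
  by case: (i == j); [apply: measurable_funN|]; exact: mX.
have mstj : measurable_fun setT (fun w => (stopped lam (fwd (X ^~ w)) j ^+ 2)%R).
  by apply: measurable_funX; exact: mcomp (mst _ (ltnW jn)).
have mX2 : measurable_fun setT (fun w => (X j w ^+ 2)%R).
  by apply: measurable_funX; exact: mX.
have mgX2 : measurable_fun setT (fun w => (g ^+ 2 * X j w ^+ 2)%R).
  exact: measurable_funM.
apply: (@le_trans _ _ 'E_P[fun w =>
    (stopped lam (fwd (X ^~ w)) j ^+ 2 + g ^+ 2 * X j w ^+ 2)%R]); last first.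
  rewrite ge0_expectationD//; last 2 first.
  - by move=> w; exact: sqr_ge0.
  - by move=> w; rewrite mulr_ge0 ?sqr_ge0.
  rewrite ge0_expectationZ ?sqr_ge0//; last by move=> w; exact: sqr_ge0.
  by rewrite leeD2l// [leRHS]EFinM lee_wpmul2l ?lee_fin ?sqr_ge0// sqrX.
apply: (@expectation_le_average 1 _ G).
- by case=> [|i] _; [exact: mcomp mF|exact: (measurableT_comp mF)].
- by move=> i w; rewrite /G /F; case: ifP => _; exact: sqr_ge0.
- by case=> [//|[|//]] _; exact: (expectation_flip mX iidX jn nuN mF (fun=> sqr_ge0 _)).
- exact: measurable_funD.
- by move=> w; rewrite addr_ge0 ?sqr_ge0// mulr_ge0 ?sqr_ge0.
move=> w; rewrite !big_ord_recl big_ord0 addr0 /G /F /=.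
set x := (X ^~ w).
have -> : stopped lam (fwd (flip x)) j = stopped lam (fwd x) j.
  apply: eq_stopped => i ij; rewrite /fwd /flip (ltn_eqF ij); congr (phi _ * _)%R.
  by apply: eq_psum => k ki; rewrite ltn_eqF// (ltn_trans ki).
have -> : fwd (flip x) j = (- fwd x j)%R.
  rewrite /fwd {2}/flip eqxx mulrN; congr (- (phi _ * _))%R.
  by apply: eq_psum => k ki; rewrite /flip ltn_eqF.
set a := stopped _ _ _.
have H : (fwd x j ^+ 2 <= g ^+ 2 * x j ^+ 2)%R.
  by rewrite /fwd exprMn ler_wpM2r ?sqr_ge0.
have H0 : (0 <= g ^+ 2 * x j ^+ 2)%R by rewrite mulr_ge0 ?sqr_ge0.
(* If frozen, both squares are [a ^+ 2]. Otherwise, with [d = fwd x j], they are the squares of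
   [a + d] and [a - d], whose sum is twice [a ^+ 2 + d ^+ 2]. *)
rewrite /x in H H0 *; case: ifP => _; nra.
Qed.

(** Increments of the reversed martingale, numbered from the last interval backwards so that
    [stopped] reads them in the order in which the reversed filtration grows. *)
Definition bwd (x : nat -> R) (r : nat) : R :=
  (phi (psum x (n - r)) * (x (n - r.+1)%N - psum x (n - r) / (n - r)%:R))%R.

Lemma measurable_bwd r : (r < n)%N ->
  measurable_fun [set: seqspace R n] (fun x => bwd x r).
Proof.
move=> rn.
have m : measurable_fun [set: seqspace R n] (fun x => psum x (n - r)).
  by apply: measurable_psum; exact: leq_subr.
apply: measurable_funM; first exact: measurableT_comp.
apply: measurable_funB; last exact: measurable_funM.
by apply: measurable_coord; rewrite ltn_subrL (leq_ltn_trans _ rn).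
Qed.

(* With [k = n - r.+1], the terms up to [r] depend on [X 0, ..., X k] only through
   their sum, so [X k] may be exchanged with any [X i], [i <= k], and the
   centered increments [X i - psum / k.+1] sum to zero. *)
Lemma backward_maximal :
  P [set w | lam < `|stopped lam (bwd (X ^~ w)) n|]%R <=
    (n%:R * (g ^+ 2 * v) / lam ^+ 2)%:E.
Proof.
apply: stopped_tail => //.
  by move=> i ni; exact: mcomp (measurable_bwd ni).
move=> r rn.
have mst i : (i <= n)%N ->
    measurable_fun [set: seqspace R n] (fun x => stopped lam (bwd x) i).
  by move=> ni; apply: measurable_stopped => k ki;
    apply: measurable_bwd; exact: leq_trans ni.
pose k := (n - r.+1)%N.
have nrk : (n - r = k.+1)%N by rewrite /k -subSn// subSS.
have kn : (k < n)%N by rewrite -nrk leq_subr.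
pose F (x : seqspace R n) := (stopped lam (bwd x) r.+1 ^+ 2)%R.
pose swp i (x : seqspace R n) : seqspace R n := fun j => x (swapn i k j).
have mF : measurable_fun setT F by apply: measurable_funX; exact: mst.
have mX2 i : (i < k.+1)%N -> measurable_fun setT (fun w => (X i w ^+ 2)%R).
  by move=> ik; apply: measurable_funX; apply: mX; exact: leq_trans kn.
have mstr : measurable_fun setT (fun w => (stopped lam (bwd (X ^~ w)) r ^+ 2)%R).
  by apply: measurable_funX; exact: mcomp (mst _ (ltnW rn)).
have c0 : (0 <= g ^+ 2 / k.+1%:R)%R by rewrite divr_ge0 ?sqr_ge0 ?ler0n.
have mS : measurable_fun setT
    (fun w => (g ^+ 2 / k.+1%:R * \sum_(i < k.+1) X i w ^+ 2)%R).
  apply: measurable_funM => //.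
  by apply: measurable_sum => i; exact: mX2.
have S0 w : (0 <= \sum_(i < k.+1) X i w ^+ 2)%R.
  by apply: sumr_ge0 => i _; exact: sqr_ge0.
apply: (@le_trans _ _ 'E_P[fun w => (stopped lam (bwd (X ^~ w)) r ^+ 2 +
    g ^+ 2 / k.+1%:R * \sum_(i < k.+1) X i w ^+ 2)%R]); last first.
  rewrite ge0_expectationD//; last 2 first.
  - by move=> w; exact: sqr_ge0.
  - by move=> w; rewrite mulr_ge0.
  rewrite ge0_expectationZ//; last first.
    by apply: measurable_sum => i; exact: mX2.
  rewrite leeD2l//.
  rewrite (@ge0_expectation_sum _ _ _ _ _ (fun i w => (X i w ^+ 2)%R))//; last first.
    by move=> i w _; exact: sqr_ge0.
  apply: (@le_trans _ _ ((g ^+ 2 / k.+1%:R)%:E * \sum_(i < k.+1) v%:E)).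
    rewrite lee_wpmul2l ?lee_fin//; apply: lee_sum => i _; apply: sqrX.
    exact: leq_trans kn.
  rewrite sumEFin sumr_const card_ord -EFinM lee_fin -[(v *+ _)%R]mulr_natl.
  by rewrite mulrA divfK// pnatr_eq0.
apply: (@expectation_le_average k _ (fun i w => F (swp i (X ^~ w)))).
- move=> i ik; apply: (measurableT_comp mF).
  apply: measurable_to_seqspace => j jn; apply: mX; apply: swapn_ltn => //.
  exact: leq_trans kn.
- by move=> i w; exact: sqr_ge0.
- move=> i ik; apply: (expectation_swap mX iidX _ kn mF (fun=> sqr_ge0 _)).
  exact: leq_trans kn.
- exact: measurable_funD.
- by move=> w; rewrite addr_ge0 ?sqr_ge0// mulr_ge0 ?sqr_ge0.
move=> w; rewrite /F /=; set x := (X ^~ w); set a := stopped lam (bwd x) r.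
have Ea i : (i < k.+1)%N -> stopped lam (bwd (swp i x)) r = a.
  move=> ik; apply: eq_stopped => q qr.
  have kq : (k < n - q.+1)%N by rewrite /k ltn_sub2l// (leq_ltn_trans _ rn).
  have kq' : (k < n - q)%N by rewrite (leq_trans kq)// leq_sub2l.
  have iq : (i < n - q.+1)%N by rewrite (leq_trans ik).
  have iq' : (i < n - q)%N by rewrite (leq_trans ik).
  rewrite /bwd /swp psum_swap//; congr (_ * (_ - _))%R; congr x.
  by rewrite /swapn !gtn_eqF.
have Ed i : (i < k.+1)%N -> bwd (swp i x) r =
    (phi (psum x k.+1) * (x i - psum x k.+1 / k.+1%:R))%R.
  move=> ik; rewrite /bwd /swp nrk psum_swap// -/k; congr (_ * (_ - _))%R.
  by congr x; rewrite /swapn eqxx; case: eqP.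
set b := phi (psum x k.+1) in Ed *; set m := (psum x k.+1 / k.+1%:R)%R in Ed *.
rewrite (eq_bigr (fun i : 'I_k.+1 =>
  ((if lam < `|a| then a else a + b * (x i - m)) ^+ 2)%R)); last first.
  by move=> i _; rewrite Ea// Ed.
have -> : (k.+1%:R * (a ^+ 2 + g ^+ 2 / k.+1%:R * \sum_(i < k.+1) X i w ^+ 2) =
    k.+1%:R * a ^+ 2 + g ^+ 2 * \sum_(i < k.+1) x i ^+ 2)%R.
  rewrite mulrDr; congr (_ + _)%R.
  by rewrite mulrA [(k.+1%:R * _)%R]mulrCA divff ?pnatr_eq0// mulr1.
case: (lam < `|a|)%R.
  by rewrite sumr_const card_ord -[(_ *+ _)%R]mulr_natl lerDl mulr_ge0 ?sqr_ge0// S0.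
rewrite (le_trans (sum_sqr_centered _ _ _ _))// lerD2l ler_wpM2r ?sqr_phi//.
exact: S0.
Qed.

End iid_maximal.
End maximal.

(** * Symmetry and moment bounds of the centred normal law *)

Section normal_moments.
Context (R : realType).
Local Notation mu := (@lebesgue_measure R).
Local Open Scope ereal_scope.

Lemma normal_probN (s : R) (B : set R) : s != 0%R -> measurable B ->
  normal_prob 0 s [set x | B (- x)%R] = normal_prob 0 s B.
Proof.
move=> s0 mB; rewrite /normal_prob.
have mf : measurable_fun B (fun x => (normal_pdf 0 s x)%:E).
  by apply/measurable_funTS/measurable_EFinP; exact: measurable_normal_pdf.
have E : \int[pushforward mu (-%R : _ -> measurableTypeR R)]_(x in B)
    (normal_pdf 0 s x)%:E = \int[mu]_(x in B) (normal_pdf 0 s x)%:E.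
  by apply: eq_measure_integral => A mA _; exact: lebesgue_measureN.
rewrite -[RHS]E.
transitivity (\int[mu]_(x in (-%R : _ -> measurableTypeR R) @^-1` B)
    (normal_pdf 0 s (- x))%:E).
  by apply: eq_integral => x _; rewrite !normal_pdfE// /normal_fun !subr0 sqrrN.
apply/esym; apply: ge0_integral_pushforward => //.
by move=> x _; rewrite lee_fin normal_pdf_ge0.
Qed.

(** Change of variables holds for the Radon-Nikodym derivative of [normal_prob], and this derivative
    equals [normal_pdf] almost everywhere because both have the same integral over every measurable
    set. *)
Lemma ge0_integral_normal_prob (s : R) (f : R -> \bar R) :
  measurable_fun setT f -> (forall x, 0 <= f x) ->
  \int[normal_prob 0 s]_x f x = \int[mu]_x (f x * (normal_pdf 0 s x)%:E).
Proof.
move=> mf f0.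
have dom := normal_prob_dominates 0 s.
have mpdf : measurable_fun setT (fun x => (normal_pdf 0 s x)%:E).
  by apply/measurable_EFinP; exact: measurable_normal_pdf.
rewrite -(Radon_Nikodym_SigmaFinite.change_of_variables dom f0)//.
have int_rn := Radon_Nikodym_SigmaFinite.f_integrable dom.
apply: ge0_ae_eq_integral => //.
- by apply: emeasurable_funM => //; exact: measurable_int int_rn.
- exact: emeasurable_funM.
- by move=> x _; rewrite mule_ge0// Radon_Nikodym_SigmaFinite.f_ge0.
- by move=> x _; rewrite mule_ge0// lee_fin normal_pdf_ge0.
- apply: ae_eqe_mul2l; apply: integral_ae_eq => //.
  by move=> E _ mE; rewrite -Radon_Nikodym_SigmaFinite.f_integral.
Qed.

(* Half of the exponent absorbs polynomial factors; the other half is, up to a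
   constant, the density with standard deviation [sqrt 2 * s]. *)
Lemma normal_pdf_sqrt2 (s x : R) : (0 < s)%R ->
  (normal_pdf 0 s x <=
   3 / 2 * expR (- (x ^+ 2 / (4 * s ^+ 2))) * normal_pdf 0 (Num.sqrt 2 * s) x)%R.
Proof.
move=> s0.
have r0 : (0 < Num.sqrt 2 :> R)%R by rewrite sqrtr_gt0.
have r2 : (Num.sqrt 2 ^+ 2 = 2 :> R)%R by rewrite sqr_sqrtr.
rewrite !normal_pdfE ?gt_eqF ?mulr_gt0// /normal_fun /normal_peak !subr0.
rewrite exprMn r2.
have -> : (2 * s ^+ 2 * pi *+ 2 = 2 * (s ^+ 2 * pi *+ 2))%R.
  by ring.
rewrite sqrtrM// [(Num.sqrt 2 * _)^-1%R]invfM.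
set p := (Num.sqrt _)^-1%R.
have p0 : (0 <= p)%R by rewrite invr_ge0 sqrtr_ge0.
have -> : (- x ^+ 2 / (s ^+ 2 *+ 2) = - (x ^+ 2 / (4 * s ^+ 2)) +
    - x ^+ 2 / (2 * s ^+ 2 *+ 2))%R.
  by field; rewrite gt_eqF.
rewrite expRD.
set a := expR _; set b := expR _.
have a0 : (0 <= a)%R by exact: expR_ge0.
have b0 : (0 <= b)%R by exact: expR_ge0.
(* The factor 3/2 is a rational upper bound for the square root of 2, the ratio of the two peak
   heights. *)
have H : (1 <= 3 / 2 * (Num.sqrt 2)^-1 :> R)%R.
  by rewrite ler_pdivlMr// mul1r -ler_sqr ?nnegrE ?sqrtr_ge0// r2; lra.
rewrite [leRHS](_ : _ = 3 / 2 * (Num.sqrt 2)^-1 * (p * (a * b)))%R; last by ring.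
by rewrite ler_peMl ?mulr_ge0.
Qed.

(** After half of the exponent has been spent on [f], the wider normal density remains, and it has
    total mass 1. *)
Let le_normal_moment (s c : R) (f : R -> R) : (0 < s)%R -> (0 <= c)%R ->
  measurable_fun setT f -> (forall x, 0 <= f x)%R ->
  (forall x, f x * expR (- (x ^+ 2 / (4 * s ^+ 2))) <= c)%R ->
  \int[normal_prob 0 s]_x (f x)%:E <= (3 / 2 * c)%:E.
Proof.
move=> s0 c0 mf f0 fc; have mfE : measurable_fun setT (fun x => (f x)%:E) by exact/measurable_EFinP.
rewrite ge0_integral_normal_prob//.
have s20 : (0 < Num.sqrt 2 * s)%R by rewrite mulr_gt0// sqrtr_gt0.
rewrite -[leRHS]mule1 -(integral_normal_pdf 0 (Num.sqrt 2 * s)).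
rewrite -ge0_integralZl_EFin//; last 3 first.
- by move=> x _; rewrite lee_fin normal_pdf_ge0.
- by apply/measurable_EFinP; exact: measurable_normal_pdf.
- by rewrite mulr_ge0.
apply: ge0_le_integral => //.
- by move=> x _; rewrite -EFinM lee_fin mulr_ge0// normal_pdf_ge0.
- apply/measurable_EFinP; apply: measurable_funM => //.
  exact: measurable_normal_pdf.
- apply/measurable_EFinP; apply: measurable_funM => //.
  exact: measurable_normal_pdf.
move=> x _; rewrite -!EFinM lee_fin.
apply: (le_trans (ler_wpM2l (f0 x) (normal_pdf_sqrt2 x s0))).
rewrite mulrA ler_wpM2r ?normal_pdf_ge0//.
by rewrite mulrCA ler_wpM2l//.
Qed.

(** With [y = x ^+ 2 / (4 * s ^+ 2)] the bound is [y <= expR y]; the constant is 6 = (3/2) 4. *)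
Lemma normal_moment2 (s : R) : (0 < s)%R ->
  \int[normal_prob 0 s]_x (x ^+ 2)%:E <= (6 * s ^+ 2)%:E.
Proof.
move=> s0; have -> : (6 * s ^+ 2 = 3 / 2 * (4 * s ^+ 2))%R by field.
apply: le_normal_moment => //.
- by rewrite mulr_ge0 ?sqr_ge0.
- by move=> x; exact: sqr_ge0.
move=> x; set y := (x ^+ 2 / _)%R.
have c0 : (0 < 4 * s ^+ 2)%R by rewrite mulr_gt0// exprn_gt0.
have -> : (x ^+ 2 = 4 * s ^+ 2 * y)%R by rewrite /y mulrCA divff ?mulr1// gt_eqF.
rewrite -mulrA ler_piMr ?(ltW c0)// expRN ler_pdivrMr ?expR_gt0// mul1r.
by apply: le_trans (expR_ge1Dx y); rewrite lerDr.
Qed.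

(** With the same [y], the bound is [y ^+ 2 / 2 <= expR y]; the constant is 48 = (3/2) 32. *)
Lemma normal_moment4 (s : R) : (0 < s)%R ->
  \int[normal_prob 0 s]_x (x ^+ 4)%:E <= (48 * s ^+ 4)%:E.
Proof.
move=> s0; have -> : (48 * s ^+ 4 = 3 / 2 * (32 * s ^+ 4))%R by field.
apply: le_normal_moment => //.
- by rewrite mulr_ge0// exprn_ge0// ltW.
- by move=> x; rewrite exprn_even_ge0.
move=> x; set y := (x ^+ 2 / _)%R.
have c0 : (0 < 4 * s ^+ 2)%R by rewrite mulr_gt0// exprn_gt0.
have y0 : (0 <= y)%R by rewrite divr_ge0 ?sqr_ge0// ltW.
have -> : (x ^+ 4 = 32 * s ^+ 4 * (y ^+ 2 / 2))%R.
  have -> : (x ^+ 4 = (x ^+ 2) ^+ 2)%R by rewrite -exprM.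
  have -> : (x ^+ 2 = 4 * s ^+ 2 * y)%R by rewrite /y mulrCA divff ?mulr1// gt_eqF.
  by field.
rewrite -mulrA ler_piMr ?mulr_ge0 ?exprn_ge0 ?(ltW s0)//.
rewrite expRN ler_pdivrMr ?expR_gt0// mul1r.
apply: le_trans (@expR_ge1Dxn _ y 1%N y0).
by rewrite lerDr.
Qed.

End normal_moments.

(** * Independence and concentration of a sum of squares *)

Section independence.
Context (R : realType) (d : measure_display) (T : measurableType d).
Variable P : probability T R.
Local Open Scope ereal_scope.

Lemma ge0_expectation_law (X : T -> R) (nu : {measure set R -> \bar R})
    (f : R -> R) : measurable_fun setT X ->
  (forall B : set R, measurable B -> P (X @^-1` B) = nu B) ->
  measurable_fun setT f -> (forall x, 0 <= f x)%R ->
  'E_P[fun w => f (X w)] = \int[nu]_x (f x)%:E.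
Proof.
move=> mX XE mf f0; rewrite unlock.
transitivity (\int[pushforward P X]_x (f x)%:E).
  rewrite ge0_integral_pushforward//.
  - exact/measurable_EFinP.
  - by move=> x _; rewrite lee_fin.
by apply: eq_measure_integral => B mB _; exact: XE.
Qed.

Lemma ge0_expectation_normal (X : T -> R) (s : R) (f : R -> R) :
  measurable_fun setT X ->
  (forall B : set R, measurable B -> P (X @^-1` B) = normal_prob 0 s B) ->
  measurable_fun setT f -> (forall x, 0 <= f x)%R ->
  'E_P[fun w => f (X w)] = \int[normal_prob 0 s]_x (f x)%:E.
Proof.
move=> mX XE mf f0; rewrite unlock.
have mX' : measurable_fun setT (X : T -> measurableTypeR R) by exact: mX.
transitivity (\int[pushforward P (X : T -> measurableTypeR R)]_x (f x)%:E).
  rewrite ge0_integral_pushforward//.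
  - exact/measurable_EFinP.
  - by move=> x _; rewrite lee_fin.
by apply: eq_measure_integral => B mB _; exact: XE.
Qed.

(** The joint law agrees with the product of the marginals on rectangles, hence everywhere, and
    Tonelli's theorem separates the integral. *)
Lemma expectation_indep (X Y : T -> R) (f g : R -> R) :
  measurable_fun setT X -> measurable_fun setT Y ->
  (forall A B : set R, measurable A -> measurable B ->
     P ((X @^-1` A) `&` (Y @^-1` B)) = P (X @^-1` A) * P (Y @^-1` B)) ->
  measurable_fun setT f -> measurable_fun setT g ->
  (forall x, 0 <= f x)%R -> (forall x, 0 <= g x)%R ->
  'E_P[fun w => (f (X w) * g (Y w))%R] =
  'E_P[fun w => f (X w)] * 'E_P[fun w => g (Y w)].
Proof.
move=> mX mY XY mf mg f0 g0.
have mXY : measurable_fun setT (fun w => (X w, Y w)) by exact: measurable_fun_pair.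
pose X' : {mfun T >-> R} := HB.pack X (isMeasurableFun.Build _ _ _ _ _ mX).
pose Y' : {mfun T >-> R} := HB.pack Y (isMeasurableFun.Build _ _ _ _ _ mY).
pose XY' : {mfun T >-> (R * R)%type} :=
  HB.pack (fun w => (X w, Y w)) (isMeasurableFun.Build _ _ _ _ _ mXY).
pose m1 := distribution P X'; pose m2 := distribution P Y'.
rewrite (@ge0_expectation_law X m1)// (@ge0_expectation_law Y m2)// unlock.
have mh : measurable_fun setT (fun z : R * R => (f z.1 * g z.2)%:E).
  apply/measurable_EFinP; apply: measurable_funM.
    by apply: measurableT_comp => //; exact: measurable_fst.
  by apply: measurableT_comp => //; exact: measurable_snd.
have h0 (z : R * R) : 0 <= (f z.1 * g z.2)%:E by rewrite lee_fin mulr_ge0.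
transitivity (\int[m1 \x m2]_z (f z.1 * g z.2)%:E).
  transitivity (\int[distribution P XY']_z (f z.1 * g z.2)%:E).
    by rewrite ge0_integral_pushforward.
  apply: eq_measure_integral => A mA _; apply/esym.
  apply: (@product_measure_unique _ _ _ _ _ m1 m2 (distribution P XY')) => //.
rewrite fubini_tonelli1//.
have fE0 x : 0 <= (f x)%:E by rewrite lee_fin.
have gE0 x : 0 <= (g x)%:E by rewrite lee_fin.
transitivity (\int[m1]_x ((f x)%:E * \int[m2]_y (g y)%:E)).
  apply: eq_integral => x _; rewrite -ge0_integralZl//; first exact/measurable_EFinP.
rewrite ge0_integralZr//; first exact/measurable_EFinP.
exact: integral_ge0.
Qed.

Section sum_sqr.
Variables (n : nat) (X : nat -> T -> R) (v q : R).
Hypothesis mX : forall k, (k < n)%N -> measurable_fun setT (X k).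
Hypothesis indepX : forall k l, (k < n)%N -> (l < n)%N -> k != l ->
  forall A B : set R, measurable A -> measurable B ->
  P ((X k @^-1` A) `&` (X l @^-1` B)) = P (X k @^-1` A) * P (X l @^-1` B).
Hypothesis EX2 : forall k, (k < n)%N -> 'E_P[fun w => (X k w ^+ 2)%R] = v%:E.
Hypothesis EX4 : forall k, (k < n)%N -> 'E_P[fun w => (X k w ^+ 4)%R] <= q%:E.

(** Chebyshev for the sum of squares: the off-diagonal terms of its second moment equal [v ^+ 2] and
    are absorbed by the squared mean, so the variance is at most [n * q]. *)
Lemma sum_sqr_tail (a : R) : (0 < a)%R -> (0 <= v)%R -> (0 <= q)%R ->
  P [set w | a < `|\sum_(k < n) X k w ^+ 2 - n%:R * v|]%R <=
  (n%:R * q / a ^+ 2)%:E.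
Proof.
move=> a0 v0 q0; set c := (n%:R * v)%R; pose S w := (\sum_(k < n) X k w ^+ 2)%R.
have c0 : (0 <= c)%R by rewrite mulr_ge0.
have mX2 k : (k < n)%N -> measurable_fun setT (fun w => (X k w ^+ 2)%R).
  by move=> kn; apply: measurable_funX; exact: mX.
have mS : measurable_fun setT S.
  by apply: measurable_sum => k; exact: mX2.
have S0 w : (0 <= S w)%R by apply: sumr_ge0 => k _; exact: sqr_ge0.
have ES : 'E_P[S] = c%:E.
  rewrite (@ge0_expectation_sum _ _ _ P n (fun k w => (X k w ^+ 2)%R))//; last first.
    by move=> k w _; exact: sqr_ge0.
  rewrite (eq_bigr (fun=> v%:E)); last by move=> k _; rewrite EX2.
  by rewrite sumEFin sumr_const card_ord /c mulr_natl.
have ES2 : 'E_P[fun w => (S w ^+ 2)%R] <= (n%:R * q + c ^+ 2)%:E.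
  have -> : (fun w => (S w ^+ 2)%R) =
      (fun w => \sum_(k < n) \sum_(l < n) X k w ^+ 2 * X l w ^+ 2)%R.
    by apply/funext => w; rewrite expr2 mulr_suml; apply: eq_bigr => k _; rewrite mulr_sumr.
  have mkl k l : (k < n)%N -> (l < n)%N ->
      measurable_fun setT (fun w => (X k w ^+ 2 * X l w ^+ 2)%R).
    by move=> kn ln; apply: measurable_funM; exact: mX2.
  rewrite (@ge0_expectation_sum _ _ _ P n
    (fun k w => \sum_(l < n) X k w ^+ 2 * X l w ^+ 2)%R); last 2 first.
  - by move=> k kn; apply: measurable_sum => l; exact: mkl.
  - by move=> k w _; apply: sumr_ge0 => l _; rewrite mulr_ge0 ?sqr_ge0.
  apply: (@le_trans _ _ (\sum_(k < n) (q + n%:R * v ^+ 2)%:E)); last first.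
    rewrite sumEFin sumr_const card_ord lee_fin -[(_ *+ _)%R]mulr_natl /c.
    by rewrite mulrDr exprMn mulrA -expr2.
  apply: lee_sum => k _.
  rewrite (@ge0_expectation_sum _ _ _ P n
    (fun l w => X k w ^+ 2 * X l w ^+ 2)%R); last 2 first.
  - by move=> l ln; exact: mkl.
  - by move=> l w _; rewrite mulr_ge0 ?sqr_ge0.
  apply: (@le_trans _ _ (\sum_(l < n) ((l == k)%:R * q + v ^+ 2)%:E)); last first.
    rewrite sumEFin lee_fin big_split/= -mulr_suml sumr_const card_ord mulr_natl.
    by rewrite lerD2r (bigD1 k)//= eqxx big1 ?addr0 ?mul1r// => l /negbTE ->.
  apply: lee_sum => l _; have [->|lk] := eqVneq l k.
    rewrite mul1r; have -> : (fun w => X k w ^+ 2 * X k w ^+ 2)%R = (fun w => X k w ^+ 4)%R.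
      by apply/funext => w; rewrite -exprD.
    by rewrite (le_trans (EX4 _))// lee_fin lerDl sqr_ge0.
  rewrite mul0r add0r (@expectation_indep (X k) (X l) (fun x => x ^+ 2)%R (fun x => x ^+ 2)%R).
  - by rewrite !EX2// -EFinM lee_fin.
  - exact: mX.
  - exact: mX.
  - by apply: indepX => //; rewrite eq_sym.
  - exact: exprn_measurable.
  - exact: exprn_measurable.
  - by move=> x; exact: sqr_ge0.
  - by move=> x; exact: sqr_ge0.
have mSc : measurable_fun setT (fun w => S w - c)%R by exact: measurable_funB.
apply: (le_trans (probability_gt_sqr P a0 mSc)).
rewrite mulrC EFinM lee_pmul2l// ?lte_fin ?invr_gt0 ?exprn_gt0//.
(* The variance identity is arranged with nonnegative terms on both sides, so that additivity of
   nonnegative expectations suffices; the finite term [2 * c * c] is cancelled afterwards. *)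
have E : 'E_P[fun w => ((S w - c) ^+ 2 + 2 * c * S w)%R] =
    'E_P[fun w => (S w ^+ 2 + c ^+ 2)%R].
  by congr expectation; apply/funext => w; ring.
have mS2 := measurable_funX 2 mS; have mSc2 := measurable_funX 2 mSc.
have c20 : (0 <= 2 * c)%R by rewrite mulr_ge0.
have mcS : measurable_fun setT (fun w => 2 * c * S w)%R by exact: measurable_funM.
have Sc0 w : (0 <= (S w - c) ^+ 2)%R by exact: sqr_ge0.
have S20 w : (0 <= S w ^+ 2)%R by exact: sqr_ge0.
have cS0 w : (0 <= 2 * c * S w)%R by rewrite mulr_ge0.
have cc0 (w : T) : (0 <= c ^+ 2)%R by exact: sqr_ge0.
rewrite (ge0_expectationD P mSc2 mcS)// (ge0_expectationD P mS2 (measurable_cst (c ^+ 2)%R))// in E.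
rewrite ge0_expectationZ// in E.
rewrite ES expectation_cst in E.
rewrite -(@leeD2rE _ (2 * c * c)%:E)// EFinM E.
apply: (le_trans (leeD2r _ ES2)).
by rewrite -!EFinD lee_fin le_eqVlt; apply/orP; left; apply/eqP; ring.
Qed.

End sum_sqr.
End independence.

(** * Hoelder functions and their Lipschitz approximation *)

Section hoelder.
Context (R : realType).
Implicit Types (f : R -> R) (C L M a h : R).

(** Points at distance [r] below [d0 / 2] are compared through [osc f (2 * r)], doubled because
    [osc] uses a strict inequality; farther points are covered by the bound [2 * M]. The constant
    adds the two cases. *)
Lemma hoelder_of_osc f M C a d0 : 0 < a -> 0 < C -> 0 < d0 ->
  (forall x, `|f x| <= M) ->
  (forall e, 0 < e < d0 -> osc f e <= C * e `^ a) ->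
  exists2 C', 0 < C' & forall s t, `|f s - f t| <= C' * `|s - t| `^ a.
Proof.
move=> a0 C0 d00 fM oscf.
have M0 : 0 <= M by exact: le_trans (fM 0).
have d20 : 0 < d0 / 2 by rewrite divr_gt0.
have fd s t : `|f s - f t| <= 2 * M.
  by rewrite (le_trans (ler_normB _ _))// mulr_natl mulr2n lerD.
exists (C * 2 `^ a + 2 * M * (d0 / 2) `^ (- a)).
  by rewrite ltr_pwDl ?mulr_gt0 ?powR_gt0// !mulr_ge0 ?powR_ge0.
move=> s t; have [->|st] := eqVneq s t.
  by rewrite subrr normr0 mulr_ge0 ?addr_ge0 ?mulr_ge0 ?powR_ge0// ltW.
have r0 : 0 < `|s - t| by rewrite normr_gt0 subr_eq0.
set r := `|s - t| in r0 *.
rewrite mulrDl; have [rd|rd] := ltP r (d0 / 2).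
  apply: (@le_trans _ _ (C * 2 `^ a * r `^ a)); last first.
    by rewrite lerDl !mulr_ge0 ?powR_ge0.
  rewrite -mulrA -powRM ?(ltW r0)//.
  apply: (le_trans _ (oscf (2 * r) _)); last first.
    by apply/andP; split; lra.
  (* Boundedness of [f] makes the supremum in [osc] a genuine upper bound. *)
  apply: ub_le_sup.
    by exists (2 * M) => _ [x [y [_ ->]]]; exact: fd.
  by exists s, t; split => //; rewrite distrC -/r; lra.
apply: (@le_trans _ _ (2 * M * (d0 / 2) `^ (- a) * r `^ a)); last first.
  by rewrite lerDr !mulr_ge0 ?powR_ge0// ltW.
apply: (le_trans (fd s t)).
rewrite -mulrA ler_peMr ?mulr_ge0// powRN mulrC ler_pdivlMr ?powR_gt0// mul1r.
by rewrite ge0_ler_powR ?nnegrE ?(ltW a0) ?(ltW d20) ?(ltW r0).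
Qed.

Lemma hoelder_measurable f C a : 0 < a -> 0 < C ->
  (forall s t, `|f s - f t| <= C * `|s - t| `^ a) -> measurable_fun setT f.
Proof.
move=> a0 C0 fC; apply: continuous_measurable_fun => x.
apply/cvgrPdist_lt => e e0.
have eC : 0 < e / C by rewrite divr_gt0.
near=> y.
rewrite (le_lt_trans (fC x y))// mulrC -ltr_pdivlMr//.
rewrite -[ltRHS](@powRr1 _ (e / C)) ?(ltW eC)//.
rewrite -(@mulVf _ a) ?gt_eqF// powRrM gt0_ltr_powR ?nnegrE ?powR_ge0//.
near: y; apply: (@cvgr_dist_lt _ _ _ _ _ id x); first exact: cvg_id.
by rewrite powR_gt0.
Unshelve. all: by end_near. Qed.

(* The inf-convolution [x |-> inf_y (f y + L |x - y|)] with [L = C h^(a-1)]. *)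
Lemma hoelder_lipschitz_approx f C a h M : 0 < a < 1 -> 0 < C -> 0 < h ->
  (forall x, `|f x| <= M) ->
  (forall s t, `|f s - f t| <= C * `|s - t| `^ a) ->
  exists2 l : R -> R,
    (forall x y, `|l x - l y| <= C * h `^ (a - 1) * `|x - y|) &
    (forall x, `|f x - l x| <= C * h `^ a).
Proof.
move=> /andP[a0 a1] C0 h0 fM fC; set L := C * h `^ (a - 1).
have L0 : 0 <= L by rewrite mulr_ge0 ?powR_ge0// ltW.
pose E x := [set f y + L * `|x - y| | y in setT].
have E0 x : E x !=set0 by exists (f x + L * `|x - x|); exists x.
have lE x : has_lbound (E x).
  exists (- M) => _ [y _ <-]; have /ler_normlP[] := fM y.
  have := mulr_ge0 L0 (normr_ge0 (x - y)); lra.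
have le_l x y : inf (E x) <= f y + L * `|x - y|.
  by apply: ge_inf => //; exists y.
have half x y : inf (E x) <= inf (E y) + L * `|x - y|.
  rewrite -lerBlDr; apply: lb_le_inf => // _ [z _ <-].
  rewrite lerBlDr (le_trans (le_l x z))// -addrA lerD2l -mulrDr ler_wpM2l//.
  by rewrite [leRHS]addrC ler_distD.
exists (fun x => inf (E x)).
  move=> x y; rewrite ler_norml; apply/andP; split.
    by have := half y x; rewrite distrC; lra.
  by have := half x y; lra.
move=> x; rewrite ger0_norm; last first.
  by rewrite subr_ge0 (le_trans (le_l x x))// subrr normr0 mulr0 addr0.
rewrite lerBlDl -lerBlDr; apply: lb_le_inf => // _ [y _ <-].
set r := `|x - y|.
suff : C * r `^ a <= C * h `^ a + L * r.
  by have := fC x y; have := ler_norm (f x - f y); rewrite -/r; lra.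
have r0 : 0 <= r by exact: normr_ge0.
(* For [r <= h] the Hoelder bound at [r] is below the one at [h]; for [r > h] the negative exponent
   [a - 1] makes the penalty [L * r] dominate. *)
have [rh|hr] := leP r h.
  apply: (@le_trans _ _ (C * h `^ a)); last by rewrite lerDl mulr_ge0.
  by rewrite ler_pM2l// ge0_ler_powR ?nnegrE// ltW.
apply: (@le_trans _ _ (L * r)); last first.
  by rewrite lerDr mulr_ge0 ?powR_ge0// ltW.
have rp : 0 < r by exact: lt_trans hr.
rewrite /L -mulrA ler_pM2l//.
have -> : r `^ a = r `^ (a - 1) * r.
  by rewrite -[X in _ = _ * X]powRr1// -powRD ?subrK// gt_eqF// implybT.
rewrite ler_pM2r//.
have -> : a - 1 = - (1 - a) by rewrite opprB.
rewrite !powRN lef_pV2 ?posrE ?powR_gt0//.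
by rewrite ge0_ler_powR ?nnegrE ?subr_ge0// ltW.
Qed.

End hoelder.

(** * A weighted Cauchy-Schwarz inequality and square-root weights *)

Section weighted_cauchy_schwarz.
Context (R : realType).

(** Twice the difference of the two sides is the double sum of
    [w k * w l * (a k / w k - a l / w l) ^+ 2]. *)
Lemma sum_sqr_weighted (n : nat) (a w : nat -> R) : (forall k, 0 < w k) ->
  (\sum_(k < n) a k) ^+ 2 <= (\sum_(k < n) w k) * \sum_(k < n) a k ^+ 2 / w k.
Proof.
move=> w0; pose b k := a k ^+ 2 / w k.
have sum2 (u v : nat -> R) : (\sum_(k < n) u k) * (\sum_(l < n) v l) =
    \sum_(k < n) \sum_(l < n) u k * v l.
  by rewrite mulr_suml; apply: eq_bigr => k _; rewrite mulr_sumr.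
rewrite -(@ler_pM2l _ 2)// expr2 [2 * (_ * _)](_ : _ =
  \sum_(k < n) \sum_(l < n) 2 * (a k * a l)); last first.
  by rewrite sum2 mulr_sumr; apply: eq_bigr => k _; rewrite mulr_sumr.
rewrite [leRHS](_ : _ = \sum_(k < n) \sum_(l < n) (w k * b l + b k * w l)).
  apply: ler_sum => k _; apply: ler_sum => l _.
  rewrite -subr_ge0 [leRHS](_ : _ = w k * w l * (a k / w k - a l / w l) ^+ 2).
    by rewrite mulr_ge0 ?sqr_ge0// mulr_ge0// ltW.
  by rewrite /b; field; rewrite !gt_eqF.
under [RHS]eq_bigr do rewrite big_split/=.
by rewrite [RHS]big_split/= -!sum2 /b; ring.
Qed.

(** Weights of order [k] to the power -1/2 whose sum telescopes exactly. *)
Definition dsqrt (k : nat) : R := Num.sqrt k.+1%:R - Num.sqrt k%:R.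

Lemma dsqrt_gt0 k : 0 < dsqrt k.
Proof. by rewrite subr_gt0 ltr_sqrt ?ltr0n// ltr_nat. Qed.

Lemma sum_dsqrt n : \sum_(k < n) dsqrt k = Num.sqrt n%:R.
Proof.
rewrite -(big_mkord xpredT dsqrt) telescope_sumr//= sqrtr0 subr0//.
Qed.

(** For consecutive square roots [p] and [q], 1 = (p + q)(p - q) is at most 2p(p - q); squaring
    gives the claim. *)
Lemma dsqrt_inv k : (k.+1%:R * dsqrt k)^-1 <= 4 * dsqrt k.
Proof.
have d0 := dsqrt_gt0 k.
rewrite -[leLHS]mul1r ler_pdivrMr ?mulr_gt0 ?ltr0n//.
move: d0; rewrite /dsqrt.
have : Num.sqrt k.+1%:R ^+ 2 = k.+1%:R :> R by rewrite sqr_sqrtr.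
have : Num.sqrt k%:R ^+ 2 = k%:R :> R by rewrite sqr_sqrtr.
rewrite -natr1.
have := sqrtr_ge0 (k%:R : R); have := sqrtr_ge0 (k%:R + 1 : R).
set p := Num.sqrt (_ + 1); set q := Num.sqrt _ => p0 q0 <- pq d0.
rewrite -pq [leRHS](_ : _ = (2 * p * (p - q)) ^+ 2); last by ring.
suff H : 1 <= 2 * p * (p - q) by rewrite expr2; nra.
rewrite [leLHS](_ : _ = (p + q) * (p - q)); last by rewrite mulrC -subr_sqr pq; ring.
by rewrite ler_pM2r//; lra.
Qed.

End weighted_cauchy_schwarz.

(** * Second moment of the harmonically weighted sum *)

Section harmonic.
Context (R : realType) (d : measure_display) (T : measurableType d).
Variable P : probability T R.
Local Open Scope ereal_scope.

(** Cauchy-Schwarz with the weights [dsqrt] gives one factor [Num.sqrt n%:R]; by [dsqrt_inv] each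
    remaining term is at most [4 * c * dsqrt k], and these sum to the second such factor. Equal
    weights would cost a logarithm of [n]. *)
Lemma expectation_harmonic_sqr (n : nat) (S : nat -> T -> R) (c : R) :
  (0 <= c)%R ->
  (forall k, (k < n)%N -> measurable_fun setT (S k)) ->
  (forall k, (k < n)%N -> 'E_P[fun w => (S k w ^+ 2)%R] <= (k.+1%:R * c)%:E) ->
  'E_P[fun w => ((\sum_(k < n) `|S k w| / k.+1%:R) ^+ 2)%R] <= (4 * c * n%:R)%:E.
Proof.
move=> c0 mS ES.
have mSk k : (k < n)%N -> measurable_fun setT (fun w => (`|S k w| / k.+1%:R)%R).
  by move=> kn; apply: measurable_funM => //; apply: measurableT_comp => //; exact: mS.
pose u k : R := ((k.+1%:R ^+ 2 * dsqrt R k)^-1)%R.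
have u0 k : (0 <= u k)%R.
  by rewrite invr_ge0 mulr_ge0 ?sqr_ge0// ltW// dsqrt_gt0.
have mS2 k : (k < n)%N -> measurable_fun setT (fun w => (S k w ^+ 2)%R).
  by move=> kn; apply: measurable_funX; exact: mS.
have muS k : (k < n)%N -> measurable_fun setT (fun w => (u k * S k w ^+ 2)%R).
  by move=> kn; apply: measurable_funM => //; exact: mS2.
have msum : measurable_fun setT (fun w => (\sum_(k < n) u k * S k w ^+ 2)%R).
  by apply: measurable_sum => k; exact: muS.
have S20 k w : (0 <= S k w ^+ 2)%R by exact: sqr_ge0.
have uS0 k w : (0 <= u k * S k w ^+ 2)%R by rewrite mulr_ge0.
apply: (@le_trans _ _ 'E_P[fun w => (Num.sqrt n%:R * \sum_(k < n) u k * S k w ^+ 2)%R]).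
  apply: ge0_expectation_le => //.
  - by apply: measurable_funX; apply: measurable_sum => k; exact: mSk.
  - exact: measurable_funM.
  - by move=> w; exact: sqr_ge0.
  move=> w; rewrite -sum_dsqrt.
  rewrite (le_trans (sum_sqr_weighted _ (fun k => `|S k w| / k.+1%:R)%R (@dsqrt_gt0 R)))//.
  rewrite le_eqVlt; apply/orP; left; apply/eqP; congr (_ * _)%R.
  apply: eq_bigr => k _; rewrite exprMn real_normK ?num_real// /u invfM exprVn.
  by rewrite -mulrA mulrC.
rewrite ge0_expectationZ ?sqrtr_ge0//; last by move=> w; apply: sumr_ge0.
rewrite (@ge0_expectation_sum _ _ _ P n (fun k w => u k * S k w ^+ 2)%R)//.
apply: (@le_trans _ _ ((Num.sqrt n%:R)%:E * \sum_(k < n) (4 * c * dsqrt R k)%:E)).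
  rewrite lee_wpmul2l ?lee_fin ?sqrtr_ge0//; apply: lee_sum => k _.
  rewrite ge0_expectationZ//; last exact: mS2.
  apply: (@le_trans _ _ ((u k)%:E * (k.+1%:R * c)%:E)).
    by rewrite lee_wpmul2l ?lee_fin//; exact: ES.
  rewrite -EFinM lee_fin.
  rewrite [leLHS](_ : _ = c * (k.+1%:R * dsqrt R k)^-1)%R; last first.
    rewrite /u; field; rewrite gt_eqF ?dsqrt_gt0//=; rewrite addrC natr1 pnatr_eq0//.
  by rewrite [(4 * c)%R]mulrC -mulrA ler_wpM2l// dsqrt_inv.
rewrite sumEFin -mulr_sumr sum_dsqrt -EFinM lee_fin mulrCA -expr2 sqr_sqrtr//.
Qed.

End harmonic.

(** * Pathwise decomposition of the covariation sum *)

Section abel.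
Context (R : realType).
Implicit Types x : nat -> R.

Lemma sum_rev (F : nat -> R) n m : (m <= n)%N ->
  \sum_(r < m) F (n - r.+1)%N = \sum_(k < n) F k - \sum_(k < n - m) F k.
Proof.
elim: m => [|m IHm] mn; first by rewrite big_ord0 subn0 subrr.
rewrite big_ord_recr/= IHm; last exact: ltnW.
have -> : (n - m = (n - m.+1).+1)%N by rewrite -subSn// subSS.
by rewrite big_ord_recr/=; ring.
Qed.

(** If neither stopped sum has crossed [lam], all their partial sums are bounded by it. The forward
    part then costs [lam], the reversed part [2 * lam], and the harmonic sum bounds the rest for
    every [j] at once. *)
Lemma variation_bound n (phi : R -> R) (g lam : R) x j : (j <= n)%N ->
  (forall y, `|phi y| <= g) ->
  `|stopped lam (fwd phi x) n| <= lam -> `|stopped lam (bwd n phi x) n| <= lam ->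
  `|\sum_(k < j) (phi (psum x k.+1) - phi (psum x k)) * x k| <=
    3 * lam + g * \sum_(k < n) `|psum x k.+1| / k.+1%:R.
Proof.
move=> jn phig Hf Hb.
have part u i : `|stopped lam u n| <= lam -> (i <= n)%N -> `|\sum_(k < i) u k| <= lam.
  move=> Hu ni; rewrite leNgt; apply/negP => /(stopped_gt ni).
  by rewrite ltNge Hu.
pose D k := phi (psum x k.+1) * (x k - psum x k.+1 / k.+1%:R).
pose E k := phi (psum x k.+1) * (psum x k.+1 / k.+1%:R).
have -> : \sum_(k < j) (phi (psum x k.+1) - phi (psum x k)) * x k =
    \sum_(k < j) D k + \sum_(k < j) E k - \sum_(k < j) fwd phi x k.
  rewrite -big_split/= -sumrB; apply: eq_bigr => k _.
  by rewrite /D /E /fwd; ring.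
have bD i : (i <= n)%N -> \sum_(r < i) bwd n phi x r =
    \sum_(k < n) D k - \sum_(k < n - i) D k.
  move=> ni; rewrite -sum_rev//; apply: eq_bigr => r _.
  by rewrite /bwd /D -subSn ?subSS// (leq_trans _ ni).
(* The backward sums start at the end, so the first [j] terms are the full backward sum minus its
   first [n - j] terms. *)
have HD : `|\sum_(k < j) D k| <= 2 * lam.
  have -> : \sum_(k < j) D k =
      \sum_(r < n) bwd n phi x r - \sum_(r < n - j) bwd n phi x r.
    by rewrite !bD ?leq_subr// subKn// subnn big_ord0; ring.
  rewrite (le_trans (ler_normB _ _))// mulr_natl mulr2n lerD// part// leq_subr//.
have HE : `|\sum_(k < j) E k| <= g * \sum_(k < n) `|psum x k.+1| / k.+1%:R.
  apply: (@le_trans _ _ (\sum_(k < j) g * (`|psum x k.+1| / k.+1%:R))).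
    rewrite (le_trans (ler_norm_sum _ _ _))//; apply: ler_sum => k _.
    by rewrite /E normrM normf_div [`|k.+1%:R|]ger0_norm// ler_wpM2r// divr_ge0.
  rewrite -mulr_sumr ler_wpM2l//; first exact: le_trans (phig 0).
  rewrite -(big_mkord xpredT (fun k => `|psum x k.+1| / k.+1%:R)).
  rewrite -[leRHS](big_mkord xpredT (fun k => `|psum x k.+1| / k.+1%:R)).
  rewrite [leRHS](big_cat_nat (n := j))//= lerDl; apply: sumr_ge0 => k _.
  by rewrite divr_ge0.
have HF : `|\sum_(k < j) fwd phi x k| <= lam by exact: part.
rewrite (le_trans (ler_normB _ _))//.
have := ler_normD (\sum_(k < j) D k) (\sum_(k < j) E k); lra.
Qed.

End abel.

(** * Covariation sums of Brownian motion on a uniform grid *)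

Section brownian_grid.
Context (R : realType) (d : measure_display) (Omega : measurableType d).
Variables (P : probability Omega R) (W : Omega -> R -> R) (T : R) (n : nat).
Hypotheses (bmW : is_brownian_motion P W) (T0 : 0 < T) (n0 : (0 < n)%N).

Definition grid (k : nat) : R := k%:R * (T / n%:R).

Definition incr (k : nat) (w : Omega) : R := W w (grid k.+1) - W w (grid k).

Let h0 : 0 < T / n%:R. Proof. by rewrite divr_gt0// ltr0n. Qed.

Let s := Num.sqrt (T / n%:R).

Let s0 : 0 < s. Proof. by rewrite sqrtr_gt0. Qed.

Lemma grid_ge0 k : 0 <= grid k.
Proof. by rewrite mulr_ge0// ltW. Qed.

Lemma gridS k : grid k.+1 - grid k = T / n%:R.
Proof. by rewrite /grid -mulrBl -natr1 addrAC subrr add0r mul1r. Qed.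

Lemma grid_lt k : grid k < grid k.+1.
Proof. by rewrite -subr_gt0 gridS. Qed.

Lemma measurable_grid k : measurable_fun setT (W ^~ (grid k)).
Proof. by case: bmW => mW _ _ _ _; apply: mW; exact: grid_ge0. Qed.

Lemma measurable_incr k : measurable_fun setT (incr k).
Proof. by apply: measurable_funB; exact: measurable_grid. Qed.

Lemma incr_law k (B : set R) : measurable B ->
  P (incr k @^-1` B) = normal_prob 0 s B.
Proof.
case: bmW => _ _ _ lawW _ mB; rewrite /s -(gridS k).
by apply: lawW => //; [exact: grid_ge0|exact: grid_lt].
Qed.

Lemma incr_iid (B : nat -> set R) : (forall k, measurable (B k)) ->
  P (\bigcap_(k in [set k | (k < n)%N]) (incr k @^-1` B k)) =
  (\prod_(k < n) normal_prob 0 s (B k))%E.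
Proof.
case: bmW => _ _ _ _ indepW mB.
rewrite [LHS](indepW n grid _ _ B mB)//.
- by apply: eq_bigr => k _; exact: incr_law.
- exact: grid_ge0.
- by move=> k _; exact: grid_lt.
Qed.

Lemma incr_indep k l : (k < n)%N -> (l < n)%N -> k != l ->
  forall A B : set R, measurable A -> measurable B ->
  P ((incr k @^-1` A) `&` (incr l @^-1` B)) =
  (P (incr k @^-1` A) * P (incr l @^-1` B))%E.
Proof.
move=> kn ln kl A B mA mB.
pose C i := if i == k then A else if i == l then B else setT.
have mC i : measurable (C i) by rewrite /C; case: ifP => // _; case: ifP.
rewrite (_ : _ `&` _ = \bigcap_(i in [set i | (i < n)%N]) (incr i @^-1` C i)).
  rewrite incr_iid// !incr_law//.
  rewrite (bigD1 (Ordinal kn))//= (bigD1 (Ordinal ln))/=; last first.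
    by rewrite -val_eqE/= eq_sym.
  rewrite {1}/C eqxx {1}/C eqxx [l == k]eq_sym (negbTE kl) big1 ?mule1//.
  move=> i /andP[ik il]; rewrite /C -(negbK (i == k :> nat)).
  rewrite -val_eqE/= in ik; rewrite -val_eqE/= in il.
  rewrite ik (negbTE il)/=; exact: probability_setT.
apply/seteqP; split => w /=.
  move=> [Aw Bw] i ni; rewrite /C; case: eqP => [->//|_]; case: eqP => [->//|//].
move=> H; split; first by have := H k kn; rewrite /C eqxx.
by have := H l ln; rewrite /C eqxx [l == k]eq_sym (negbTE kl).
Qed.

Lemma psum_incr k w : psum (incr ^~ w) k = W w (grid k).
Proof.
rewrite /psum /incr -(big_mkord xpredT (fun i => W w (grid i.+1) - W w (grid i))).
rewrite telescope_sumr//; case: bmW => _ W0 _ _ _.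
by rewrite [grid 0]mul0r W0 subr0.
Qed.

Let sqr_s : s ^+ 2 = T / n%:R. Proof. by rewrite sqr_sqrtr// ltW. Qed.

(** The common second moment of the increments, kept as an unevaluated real number with the estimate
    [v <= 6 * (T / n%:R)]. *)
Let v := fine (\int[normal_prob 0 s]_x (x ^+ 2)%:E).

Let vE : (\int[normal_prob 0 s]_x (x ^+ 2)%:E)%E = v%:E.
Proof.
rewrite /v fineK// ge0_fin_numE.
  by rewrite (le_lt_trans (normal_moment2 s0)) ?ltry.
by apply: integral_ge0 => x _; rewrite lee_fin sqr_ge0.
Qed.

Let v0 : 0 <= v.
Proof.
by rewrite -lee_fin -vE; apply: integral_ge0 => x _; rewrite lee_fin sqr_ge0.
Qed.

Let v_le : v <= 6 * (T / n%:R).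
Proof. by rewrite -lee_fin -vE -sqr_s; exact: normal_moment2. Qed.

Let expectation_incr_sqr k : ('E_P[fun w => (incr k w ^+ 2)%R] = v%:E)%E.
Proof.
rewrite (@ge0_expectation_normal _ _ _ P (incr k) s (fun x => x ^+ 2)).
- exact: vE.
- exact: measurable_incr.
- by move=> B mB; exact: incr_law.
- exact: exprn_measurable.
- by move=> x; exact: sqr_ge0.
Qed.

Lemma expectation_incr_pow4 k :
  ('E_P[fun w => (incr k w ^+ 4)%R] <= (48 * (T / n%:R) ^+ 2)%:E)%E.
Proof.
rewrite (@ge0_expectation_normal _ _ _ P (incr k) s (fun x => x ^+ 4)).
- by rewrite (le_trans (normal_moment4 s0))// -sqr_s -exprM.
- exact: measurable_incr.
- by move=> B mB; exact: incr_law.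
- exact: exprn_measurable.
- by move=> x; rewrite exprn_even_ge0.
Qed.

Lemma expectation_grid_sqr k :
  ('E_P[fun w => (W w (grid k.+1) ^+ 2)%R] <= (k.+1%:R * (6 * (T / n%:R)))%:E)%E.
Proof.
have [_ W0 _ lawW _] := bmW.
have g0 : 0 < grid k.+1 by rewrite mulr_gt0.
rewrite (@ge0_expectation_normal _ _ _ P (W ^~ (grid k.+1))
  (Num.sqrt (grid k.+1)) (fun x => x ^+ 2)).
- rewrite (le_trans (normal_moment2 _)) ?sqrtr_gt0// lee_fin sqr_sqrtr ?grid_ge0//.
  by rewrite /grid mulrCA.
- exact: measurable_grid.
- move=> B mB; have := lawW 0 (grid k.+1) (lexx _) g0 B mB.
  rewrite subr0 => <-; congr (P _).
  by apply/seteqP; split => w /=; rewrite W0 subr0.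
- exact: exprn_measurable.
- by move=> x; exact: sqr_ge0.
Qed.

(** The exceptional event joins four: failed concentration of the squares, a crossing by either
    martingale, and a large harmonic sum. It does not depend on [j]. With [m = lam / (8 * eps)] the
    last three cost (6 + 6 + 24) [T * G ^+ 2 / m ^+ 2], and 36 times 64 is 2304; the first costs
    [48 / n] and vanishes under refinement. *)
Lemma grid_estimate (f l : R -> R) (L G lam eps : R) : 0 < lam -> 0 < eps ->
  0 <= L ->
  (forall x y, `|l x - l y| <= L * `|x - y|) ->
  (forall x, `|f x - l x| <= G) -> measurable_fun setT (fun x => f x - l x) ->
  L * eps ^+ 2 * (7 * T) <= lam / 2 ->
  exists B : set Omega, [/\ measurable B,
    (P B <= (48 / n%:R + 2304 * T * eps ^+ 2 * G ^+ 2 / lam ^+ 2)%:E)%E &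
    forall w, ~ B w -> forall j, (j <= n)%N ->
      `|cov_sum (fun w s => f (eps * W w s)) (fun w s => eps * W w s) j grid w|
        <= lam].
Proof.
move=> lam0 eps0 L0 lL lG mfl Llam.
pose phi y := f (eps * y) - l (eps * y).
have mphi : measurable_fun setT phi.
  by apply: (measurableT_comp mfl); exact: mulrl_measurable.
have phiG y : `|phi y| <= G by exact: lG.
have G0 : 0 <= G by exact: le_trans (lG 0).
(* Three units [m] from [variation_bound] and one from [H] make [eps * (4 * m) = lam / 2]. *)
pose m := lam / (8 * eps).
have m0 : 0 < m by rewrite divr_gt0// mulr_gt0.
pose H w := G * \sum_(k < n) `|W w (grid k.+1)| / k.+1%:R.
have mH : measurable_fun setT H.
  apply: measurable_funM => //; apply: measurable_sum => k.
  apply: measurable_funM => //; apply: measurableT_comp => //.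
  exact: measurable_grid.
have mincr k : (k < n)%N -> measurable_fun setT (incr k).
  by move=> _; exact: measurable_incr.
pose B1 := [set w | T < `|\sum_(k < n) incr k w ^+ 2 - n%:R * v|].
pose B2 := [set w | m < `|stopped m (fwd phi (incr ^~ w)) n|].
pose B3 := [set w | m < `|stopped m (bwd n phi (incr ^~ w)) n|].
pose B4 := [set w | m < `|H w|].
have toseq := measurable_to_seqspace mincr.
have mB1 : measurable B1.
  apply: measurable_gt_norm; apply: measurable_funB => //.
  by apply: measurable_sum => k; apply: measurable_funX; exact: mincr.
have mB2 : measurable B2.
  apply: measurable_gt_norm; apply: measurable_stopped => i ni.
  exact: (measurableT_comp (measurable_fwd mphi ni) toseq).
have mB3 : measurable B3.
  apply: measurable_gt_norm; apply: measurable_stopped => i ni.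
  exact: (measurableT_comp (measurable_bwd mphi ni) toseq).
have mB4 : measurable B4 by exact: measurable_gt_norm.
have n0R : 0 < n%:R :> R by rewrite ltr0n.
have vP k : (k < n)%N -> ('E_P[fun w => (incr k w ^+ 2)%R] <= v%:E)%E.
  by move=> _; rewrite expectation_incr_sqr.
have PB1 : (P B1 <= (48 / n%:R)%:E)%E.
  apply: (@le_trans _ _ (n%:R * (48 * (T / n%:R) ^+ 2) / T ^+ 2)%:E); last first.
    rewrite lee_fin le_eqVlt; apply/orP; left; apply/eqP.
    by field; rewrite !gt_eqF.
  apply: (sum_sqr_tail mincr incr_indep (fun k _ => expectation_incr_sqr k)
    (fun k _ => expectation_incr_pow4 k) T0 v0).
  by rewrite mulr_ge0// sqr_ge0.
have nv : n%:R * v <= 6 * T.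
  by rewrite mulrC -ler_pdivlMr// -mulrA.
have bnd : n%:R * (G ^+ 2 * v) / m ^+ 2 <= 6 * T * G ^+ 2 / m ^+ 2.
  by rewrite ler_pM2r ?invr_gt0 ?exprn_gt0// mulrCA mulrC ler_wpM2r ?sqr_ge0.
have PB2 : (P B2 <= (6 * T * G ^+ 2 / m ^+ 2)%:E)%E.
  apply: le_trans (forward_maximal mincr incr_iid vP mphi phiG m0 _) _.
    by move=> B mB; exact: normal_probN (lt0r_neq0 s0) mB.
  by rewrite lee_fin.
have PB3 : (P B3 <= (6 * T * G ^+ 2 / m ^+ 2)%:E)%E.
  apply: le_trans (backward_maximal mincr incr_iid vP mphi phiG m0) _.
  by rewrite lee_fin.
have PB4 : (P B4 <= (24 * T * G ^+ 2 / m ^+ 2)%:E)%E.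
  apply: (le_trans (probability_gt_sqr P m0 mH)).
  rewrite mulrC EFinM lee_pmul2l// ?lte_fin ?invr_gt0 ?exprn_gt0//.
  have -> : (fun w => H w ^+ 2) = (fun w =>
      G ^+ 2 * (\sum_(k < n) `|W w (grid k.+1)| / k.+1%:R) ^+ 2).
    by apply/funext => w; rewrite /H exprMn.
  rewrite ge0_expectationZ ?sqr_ge0//; last 2 first.
  - apply: measurable_funX; apply: measurable_sum => k.
    apply: measurable_funM => //; apply: measurableT_comp => //.
    exact: measurable_grid.
  - by move=> w; exact: sqr_ge0.
  apply: (@le_trans _ _ ((G ^+ 2)%:E * (4 * (6 * (T / n%:R)) * n%:R)%:E)%E).
    rewrite lee_wpmul2l ?lee_fin ?sqr_ge0//.
    apply: (@expectation_harmonic_sqr _ _ _ P n (fun k w => W w (grid k.+1))).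
    - by rewrite mulr_ge0// ltW.
    - by move=> k _; exact: measurable_grid.
    - by move=> k _; exact: expectation_grid_sqr.
  rewrite -EFinM lee_fin le_eqVlt; apply/orP; left; apply/eqP.
  by field; rewrite gt_eqF.
exists (B1 `|` (B2 `|` (B3 `|` B4))); split.
- by do 3!apply: measurableU => //.
- apply: (@le_trans _ _ (P B1 + (P B2 + (P B3 + P B4)))%E).
    have U A B : measurable A -> measurable B -> (P (A `|` B) <= P A + P B)%E.
      by move=> mA mB; exact: measureU2.
    apply: le_trans (U _ _ _ _) _ => //; first by do 2!apply: measurableU => //.
    rewrite leeD2l//; apply: le_trans (U _ _ _ _) _ => //; first exact: measurableU.
    by rewrite leeD2l// U.
  apply: le_trans (leeD PB1 (leeD PB2 (leeD PB3 PB4))) _.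
  rewrite -!EFinD lee_fin le_eqVlt; apply/orP; left; apply/eqP.
  by rewrite /m; field; rewrite !gt_eqF.
move=> w /not_orP[nB1 /not_orP[nB2 /not_orP[nB3 nB4]]] j jn.
(* The mean is at most [6 * T] and the deviation at most [T]. *)
have {nB1}S7 : \sum_(k < n) incr k w ^+ 2 <= 7 * T.
  move/negP : nB1; rewrite -leNgt => /ler_normlP[_]; lra.
have {}nB2 : `|stopped m (fwd phi (incr ^~ w)) n| <= m by rewrite leNgt; exact/negP.
have {}nB3 : `|stopped m (bwd n phi (incr ^~ w)) n| <= m by rewrite leNgt; exact/negP.
have {}nB4 : H w <= m.
  by rewrite (le_trans (ler_norm _))// leNgt; exact/negP.
have := variation_bound jn phiG nB2 nB3.
under eq_bigr do rewrite !psum_incr.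
under [X in _ <= _ + _ * X]eq_bigr do rewrite psum_incr.
rewrite -/(H w) => Vb.
have -> : cov_sum (fun w s => f (eps * W w s)) (fun w s => eps * W w s) j grid w =
    \sum_(k < j) (l (eps * W w (grid k.+1)) - l (eps * W w (grid k))) * (eps * incr k w) +
    eps * \sum_(k < j) (phi (W w (grid k.+1)) - phi (W w (grid k))) * incr k w.
  rewrite mulr_sumr -big_split/=; apply: eq_bigr => k _.
  by rewrite /phi /incr; ring.
rewrite (le_trans (ler_normD _ _))//.
have -> : lam = lam / 2 + lam / 2 by field.
apply: lerD.
  apply: le_trans Llam.
  apply: (@le_trans _ _ (\sum_(k < n) L * eps ^+ 2 * incr k w ^+ 2)); last first.
    by rewrite -mulr_sumr ler_wpM2l// mulr_ge0// sqr_ge0.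
  apply: (@le_trans _ _ (\sum_(k < j) L * eps ^+ 2 * incr k w ^+ 2)).
    rewrite (le_trans (ler_norm_sum _ _ _))//; apply: ler_sum => k _.
    rewrite normrM; apply: le_trans (ler_wpM2r (normr_ge0 _) (lL _ _)) _.
    rewrite -mulrBr -/(incr k w) -[leLHS]mulrA -expr2 real_normK ?num_real//.
    by rewrite exprMn mulrA.
  rewrite -(big_mkord xpredT (fun k => L * eps ^+ 2 * incr k w ^+ 2)).
  rewrite -[leRHS](big_mkord xpredT (fun k => L * eps ^+ 2 * incr k w ^+ 2)).
  rewrite [leRHS](big_cat_nat (n := j))//= lerDl; apply: sumr_ge0 => k _.
  by rewrite mulr_ge0 ?sqr_ge0// mulr_ge0 ?sqr_ge0.
rewrite normrM gtr0_norm//.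
have -> : lam / 2 = eps * (4 * m) by rewrite /m; field; rewrite gt_eqF.
rewrite ler_pM2l// (le_trans Vb)//; lra.
Qed.

End brownian_grid.

(** * Uniform grids and dyadic points *)

Section dyadic.
Context (R : realType).
Implicit Types (T : R) (z : R -> R).

Lemma grid_in T n j : 0 < T -> (0 < n)%N -> (j <= n)%N -> 0 <= grid T n j <= T.
Proof.
move=> T0 n0 jn; rewrite /grid mulr_ge0 ?divr_ge0 ?(ltW T0)//=.
rewrite mulrCA ler_piMr ?(ltW T0)// ler_pdivrMr ?ltr0n// mul1r ler_nat//.
Qed.

Lemma grid_refine T n q j : (0 < q)%N -> grid T (n * q) (j * q) = grid T n j.
Proof.
move=> q0; have q1 : q%:R != 0 :> R by rewrite pnatr_eq0 -lt0n.
transitivity (grid T n j * (q%:R / q%:R)); last by rewrite divff ?mulr1.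
by rewrite /grid !natrM invfM; ring.
Qed.

(** By continuity the strict inequality persists near [t] within the interval, and the dyadic point
    just left of [t] stays inside the interval. *)
Lemma exceed_dyadic T (c : R) z : 0 < T ->
  {within [set t | 0 <= t <= T], continuous z} ->
  (exists t, 0 <= t <= T /\ c < `|z t|) ->
  exists m j, (j <= 2 ^ m)%N /\ c < `|z (grid T (2 ^ m) j)|.
Proof.
move=> T0 /subspace_continuousP cz [t [tT ct]].
have : \forall s \near within [set t | 0 <= t <= T] (nbhs t), c < `|z s|.
  have /cvg_norm cn := cz t tT.
  by apply: (cvgr_gt `|z t| cn).
rewrite near_withinE => /nbhs_ballP[e /= e0 H].
have /andP[t0 tT'] := tT.
(* Then [T / e < m <= 2 ^ m], so the dyadic step is below [e]. *)
pose m := (Num.trunc (T / e)).+1.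
have m2 : T / (2 ^ m)%:R < e.
  rewrite ltr_pdivrMr ?ltr0n ?expn_gt0// mulrC -ltr_pdivrMr//.
  have /andP[_] := truncn_itv (ltW (divr_gt0 T0 e0)).
  move=> /lt_le_trans; apply; rewrite ler_nat -/m; exact/ltnW/ltn_expl.
have h0 : 0 < T / (2 ^ m)%:R by rewrite divr_gt0// ltr0n expn_gt0.
pose j := Num.trunc (t / (T / (2 ^ m)%:R)).
have /andP[j1 j2] := truncn_itv (divr_ge0 t0 (ltW h0)).
rewrite -/j ler_pdivlMr// in j1; rewrite -/j ltr_pdivrMr// in j2.
have jm : (j <= 2 ^ m)%N.
  rewrite -(ler_nat R) -(@ler_pM2r _ (T / (2 ^ m)%:R))// (le_trans j1)//.
  by rewrite mulrCA divff ?mulr1// pnatr_eq0 expn_eq0.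
exists m, j; split => //; apply: H.
  rewrite /ball/= /grid ger0_norm ?subr_ge0//.
  rewrite ltrBlDr (lt_trans j2)// -natr1 mulrDl mul1r; lra.
by apply: grid_in => //; rewrite expn_gt0.
Qed.

End dyadic.

(** * From grid sums to the supremum of the covariation *)

Section qcov_tail.
Context (R : realType) (d : measure_display) (Omega : measurableType d).
Variables (P : probability Omega R) (W : Omega -> R -> R) (T : R).
Hypotheses (bmW : is_brownian_motion P W) (T0 : 0 < T).
Variables (f l : R -> R) (L G lam eps : R) (Z : Omega -> R -> R).
Hypotheses (lam0 : 0 < lam) (eps0 : 0 < eps) (L0 : 0 <= L).
Hypothesis mf : measurable_fun setT f.
Hypothesis lL : forall x y, `|l x - l y| <= L * `|x - y|.
Hypothesis lG : forall x, `|f x - l x| <= G.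
Hypothesis mfl : measurable_fun setT (fun x => f x - l x).
Hypothesis Llam : L * eps ^+ 2 * (7 * T) <= lam / 2.
Hypothesis mZ : forall t, 0 <= t <= T -> measurable_fun setT (Z ^~ t).
Hypothesis qZ : forall t, 0 <= t <= T ->
  is_qcov_at P (fun w s => f (eps * W w s)) (fun w s => eps * W w s) t (Z ^~ t).
Hypothesis cZ : forall w, {within [set t | 0 <= t <= T], continuous (Z w)}.

Let bound := 2304 * T * eps ^+ 2 * G ^+ 2 / lam ^+ 2.

Let cov j n w :=
  cov_sum (fun w s => f (eps * W w s)) (fun w s => eps * W w s) j (grid T n) w.

Let measurable_cov j n : (0 < n)%N -> measurable_fun setT (cov j n).
Proof.
move=> n0; apply: measurable_sum => k.
have mW i : measurable_fun setT (fun w => eps * W w (grid T n i)).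
  by apply: measurable_funM => //; exact: (measurable_grid bmW T0 n0 i).
by apply: measurable_funM; apply: measurable_funB => //; exact: measurableT_comp.
Qed.

(** Each cell is cut into [q] pieces. The covariation sums on the finer grid are at most [lam] off
    the exceptional event, and within [lam] of [Z] at the [N.+1] coarse points by convergence in
    probability; hence the level [2 * lam]. *)
Lemma qcov_grid_tail (N : nat) : (0 < N)%N ->
  (P (\bigcup_(j in [set j | (j < N.+1)%N])
     [set w | (2 * lam < `|Z w (grid T N j)|)%R]) <= bound%:E)%E.
Proof.
move=> N0; apply/lee_addgt0Pr => e e0.
have N0R : 0 < N%:R :> R by rewrite ltr0n.
(* The [N.+1] approximation errors share one half of [e]; the other half pays for [48 / (N * q)]. *)
pose e' := e / (2 * N.+1%:R).
have e'0 : 0 < e' by rewrite divr_gt0// mulr_gt0// ltr0n.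
have tj j : (j < N.+1)%N -> 0 <= grid T N j <= T.
  by rewrite ltnS => jN; exact: grid_in.
have /choice[q0 Hq0] : forall j, exists q0 : nat, (j < N.+1)%N ->
    forall q, (q0 < q)%N ->
    (P [set w | (lam < `|cov (j * q) (N * q) w - Z w (grid T N j)|)%R] <= e'%:E)%E.
  move=> j; have [jN|jN] := boolP (j < N.+1)%N; last by exists 0%N.
  have [dd [dd0 Hdd]] := qZ (tj j jN) lam0 e'0.
  exists (Num.trunc (T / dd)) => _ q qq.
  have q0 : (0 < q)%N by exact: leq_ltn_trans qq.
  have Nq0 : (0 < N * q)%N by rewrite muln_gt0 N0.
  apply: Hdd.
    split; first by rewrite /grid mul0r.
    - exact: grid_refine.
    - by move=> k _; exact: grid_lt.
  apply: bigmax_lt => // k _; rewrite gridS.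
  rewrite ltr_pdivrMr ?ltr0n// mulrC -ltr_pdivrMr//.
  have /andP[_ /lt_le_trans] := truncn_itv (ltW (divr_gt0 T0 dd0)); apply.
  by rewrite ler_nat (leq_trans qq)// leq_pmull.
(* Larger than every threshold [q0 j] and than [96 / e]. *)
pose q := (\max_(j < N.+1) q0 j + Num.trunc (96 / e)).+1.
have Nq0 : (0 < N * q)%N by rewrite muln_gt0 N0.
have [B [mB PB HB]] := grid_estimate bmW T0 Nq0 lam0 eps0 L0 lL lG mfl Llam.
pose C j := [set w | lam < `|cov (j * q) (N * q) w - Z w (grid T N j)|].
have mC j : (j < N.+1)%N -> measurable (C j).
  move=> jN; apply: measurable_gt_norm; apply: measurable_funB.
    exact: measurable_cov.
  by apply: mZ; exact: tj.
have PC j : (j < N.+1)%N -> (P (C j) <= e'%:E)%E.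
  move=> jN; apply: Hq0 => //.
  rewrite ltnS (leq_trans _ (leq_addr _ _))//.
  exact: (leq_bigmax (Ordinal jN)).
have mUC : measurable (\big[setU/set0]_(j < N.+1) C j).
  by apply: bigsetU_measurable => j _; exact: mC.
apply: (@le_trans _ _ (P (B `|` \big[setU/set0]_(j < N.+1) C j))).
  apply: le_measure; rewrite ?inE.
  - apply: bigcup_measurable => j jN; apply: measurable_gt_norm.
    by apply: mZ; exact: tj.
  - exact: measurableU.
  move=> w [j jN /= Zw]; have [Bw|nBw] := pselect (B w); [by left|right].
  rewrite -bigcup_mkord; exists j => //=; rewrite /C/=.
  have := HB w nBw (j * q)%N; rewrite leq_mul2r -ltnS jN orbT => /(_ isT).
  rewrite -/(cov (j * q) (N * q) w) => cw.
  have := lerB_dist (Z w (grid T N j)) (cov (j * q) (N * q) w).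
  rewrite distrC; lra.
apply: (le_trans (measureU2 _ _ _)) => //.
apply: (@le_trans _ _ ((48 / (N * q)%:R + bound)%:E + \sum_(j < N.+1) e'%:E)%E).
  apply: leeD => //; apply: (le_trans (Boole_inequality _ mC)) => //.
  by apply: lee_sum => j _; exact: PC.
rewrite sumEFin sumr_const card_ord -!EFinD lee_fin.
have -> : e' *+ N.+1 = e / 2.
  by rewrite /e' -mulr_natr; field; rewrite addrC natr1 pnatr_eq0.
suff : 48 / (N * q)%:R <= e / 2 by lra.
rewrite ler_pdivrMr ?ltr0n// mulrC -ler_pdivrMr ?divr_gt0//.
have -> : 48 / (e / 2) = 96 / e by field; rewrite gt_eqF.
have e96 : 0 <= 96 / e by rewrite divr_ge0// ltW.
have /andP[_ /ltW/le_trans] := truncn_itv e96; apply; rewrite ler_nat.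
by rewrite (leq_trans _ (leq_pmull _ N0))// ltnS leq_addl.
Qed.

(** By path continuity the event is the increasing union of its dyadic versions, which also makes it
    measurable; continuity of the measure from below keeps the common bound. *)
Lemma qcov_sup_tail :
  (P [set w | (exists t : R, 0 <= t <= T /\ 2 * lam < `|Z w t|)%R] <= bound%:E)%E.
Proof.
pose A m := \bigcup_(j in [set j | (j < (2 ^ m).+1)%N])
  [set w | 2 * lam < `|Z w (grid T (2 ^ m) j)|].
have two0 m : (0 < 2 ^ m)%N by rewrite expn_gt0.
have mA m : measurable (A m).
  apply: bigcup_measurable => j jm; apply: measurable_gt_norm.
  by apply: mZ; exact: grid_in.
rewrite (_ : [set w | _] = \bigcup_m A m); last first.
  apply/seteqP; split => w /=.
    move=> /(exceed_dyadic T0 (@cZ w))[m [j [jm wm]]].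
    by exists m => //; exists j.
  move=> [m _ [j jm wj]]; exists (grid T (2 ^ m) j); split => //.
  exact: grid_in.
have mUA : measurable (\bigcup_m A m) by exact: bigcupT_measurable.
(* A point of index [j] on the coarser dyadic grid has index [j * 2 ^ (n - m)] on the finer one. *)
have ndA : {homo A : n m / (n <= m)%N >-> (n <= m)%O}.
  move=> m n mn; apply/subsetPset => w [j jm wj].
  exists (j * 2 ^ (n - m))%N => /=.
    by rewrite ltnS -[in leqRHS](subnKC mn) expnD leq_mul2r -ltnS jm orbT.
  by rewrite -[in (2 ^ n)%N](subnKC mn) expnD grid_refine.
have cA := nondecreasing_cvg_mu mA mUA ndA (mu := P).
rewrite -(cvg_lim _ cA)//; apply: lime_le; first by apply/cvg_ex; eexists; exact: cA.
by apply: nearW => m /=; exact: qcov_grid_tail.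
Qed.

End qcov_tail.

(** * Choice of the parameters and the rate *)

Theorem theorem1 (R : realType) (d : measure_display) (Omega : measurableType d)
  (P : probability Omega R) (W : Omega -> R -> R) (T : R) (f : R -> R)
  (alpha Cf : R) (Q : R -> Omega -> R -> R) :
  is_brownian_motion P W ->
  0 < T ->
  (exists M : R, forall x, `|f x| <= M) ->
  0 < alpha < 1 -> 0 < Cf ->
  (exists delta0 : R, 0 < delta0 /\
     forall delta, 0 < delta < delta0 -> osc f delta <= Cf * delta `^ alpha) ->
  (* Q eps = [f(eps W), eps W] on [0,T], taken with continuous paths *)
  (forall eps, 0 < eps -> forall t, 0 <= t <= T ->
     measurable_fun setT (fun w => Q eps w t) /\
     is_qcov_at P (fun w s => f (eps * W w s)) (fun w s => eps * W w s) t
       (fun w => Q eps w t)) ->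
  (forall eps, 0 < eps -> forall w,
     {within [set t | 0 <= t <= T], continuous (Q eps w)}) ->
  (forall delta gamma mu : R, 0 < delta -> 0 < gamma < alpha -> gamma < mu < alpha ->
     exists eps0 C : R, [/\ 0 < eps0, 0 < C &
       forall eps : R, 0 < eps < eps0 ->
         (P [set w | (exists t : R, 0 <= t <= T /\
                 delta < eps `^ (- (1 + gamma)) * `|Q eps w t|)%R]
          <= (C * eps `^ (2 * (alpha - mu) / (1 - alpha)))%:E)%E])
  /\
  (forall gamma : R, 0 < gamma < alpha -> forall delta eta : R, 0 < delta -> 0 < eta ->
     exists eps0 : R, 0 < eps0 /\
       forall eps : R, 0 < eps < eps0 ->
         (P [set w | (exists t : R, 0 <= t <= T /\
                 delta < eps `^ (- (1 + gamma)) * `|Q eps w t|)%R] <= eta%:E)%E).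
Proof.
move=> bmW T0 [M fM] /andP[a0 a1] Cf0 [d0 [d00 oscf]] HQ cQ.
have [C C0 fC] := hoelder_of_osc a0 Cf0 d00 fM oscf.
have mf := hoelder_measurable a0 C0 fC.
have a1' : 0 < 1 - alpha by rewrite subr_gt0.
suff main : forall delta gamma mu : R, 0 < delta -> 0 < gamma < alpha ->
    gamma < mu < alpha -> exists eps0 K : R, [/\ 0 < eps0, 0 < K &
      forall eps : R, 0 < eps < eps0 ->
        (P [set w | (exists t : R, 0 <= t <= T /\
                delta < eps `^ (- (1 + gamma)) * `|Q eps w t|)%R]
         <= (K * eps `^ (2 * (alpha - mu) / (1 - alpha)))%:E)%E].
  split=> // gamma /andP[g0 ga] delta eta delta0 eta0.
  (* Any [mu] strictly between gives a positive power of [eps], hence convergence in probability. *)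
  pose mu := (gamma + alpha) / 2.
  have gmu : gamma < mu < alpha by apply/andP; split; rewrite /mu; lra.
  have gga : 0 < gamma < alpha by rewrite g0.
  have [e0 [K [e00 K0 HK]]] := main delta gamma mu delta0 gga gmu.
  pose p := 2 * (alpha - mu) / (1 - alpha).
  have p0 : 0 < p by rewrite divr_gt0// mulr_gt0// subr_gt0; case/andP: gmu.
  have eK : 0 < eta / K by rewrite divr_gt0.
  exists (Num.min e0 ((eta / K) `^ p^-1)); split.
    by rewrite lt_min e00 powR_gt0.
  move=> eps /andP[eps0]; rewrite lt_min => /andP[epse0 epsK].
  apply: (le_trans (HK eps _)); first by rewrite eps0.
  rewrite lee_fin -/p mulrC -ler_pdivlMr//.
  rewrite [leRHS](_ : _ = ((eta / K) `^ p^-1) `^ p).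
    by rewrite ge0_ler_powR ?nnegrE ?powR_ge0 ?(ltW p0) ?(ltW eps0)// ltW.
  by rewrite -powRrM mulVf ?gt_eqF// powRr1// ltW.
move=> delta gamma mu delta0 /andP[g0 ga] /andP[gmu mua].
(* Chosen with [K] and [h] so that [h]^ (alpha - 1) = c^-1 * eps [^ (gamma - 1)], which makes the
   Lipschitz part exactly [lam / 2]. *)
pose c := 28 * C * T / delta.
have c0 : 0 < c by rewrite divr_gt0// !mulr_gt0.
pose K := c `^ (1 - alpha)^-1.
have K0 : 0 < K by rewrite powR_gt0.
(* 9216 is 4 times 2304, the 4 coming from the half of [delta] in [lam]. *)
pose D := 9216 * (T * (C * K `^ alpha) ^+ 2 / delta ^+ 2).
have D0 : 0 < D.
  apply: mulr_gt0; first by rewrite ltr0n.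
  have CK0 : 0 < C * K `^ alpha by rewrite mulr_gt0 ?powR_gt0.
  by apply: divr_gt0; [apply: mulr_gt0 => //|]; exact: exprn_gt0.
exists 1, D; split => // eps /andP[eps0 eps1].
have epsn0 : eps != 0 by rewrite gt_eqF.
pose y := eps `^ ((1 - gamma) / (1 - alpha)).
have y0 : 0 < y by rewrite powR_gt0.
pose h := K * y.
have h0 : 0 < h by rewrite mulr_gt0.
have a01 : 0 < alpha < 1 by rewrite a0.
have [l lL lG] := hoelder_lipschitz_approx a01 C0 h0 fM fC.
pose L := C * h `^ (alpha - 1); pose G := C * h `^ alpha.
have L0 : 0 < L by rewrite mulr_gt0// powR_gt0.
pose E := eps `^ (1 + gamma).
have E0 : 0 < E by rewrite powR_gt0.
(* Half of the level, since [qcov_sup_tail] works at [2 * lam]. *)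
pose lam := delta / 2 * E.
have lam0 : 0 < lam by rewrite mulr_gt0// divr_gt0.
have hL : h `^ (alpha - 1) = c^-1 * eps `^ (gamma - 1).
  rewrite /h powRM ?(ltW K0) ?(ltW y0)//; congr (_ * _).
    rewrite /K -powRrM -[RHS]powR_inv1 ?(ltW c0)//; congr (_ `^ _).
    by field; rewrite gt_eqF.
  by rewrite /y -powRrM; congr (_ `^ _); field; rewrite gt_eqF.
have epsE : eps `^ (gamma - 1) * eps ^+ 2 = E.
  by rewrite -powR_mulrn ?(ltW eps0)// -powRD ?epsn0 ?implybT//; congr (_ `^ _); ring.
have Llam : L * eps ^+ 2 * (7 * T) <= lam / 2.
  rewrite le_eqVlt; apply/orP; left; apply/eqP.
  rewrite /L hL /lam -epsE /c; field.
  by rewrite !gt_eqF.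
have ml : measurable_fun setT l.
  apply: (@hoelder_measurable _ l L 1) => // s t.
  by rewrite powRr1// lL.
have -> : [set w | exists t : R, 0 <= t <= T /\
      delta < eps `^ (- (1 + gamma)) * `|Q eps w t|] =
    [set w | exists t : R, 0 <= t <= T /\ 2 * lam < `|Q eps w t|].
  have H w t : (delta < eps `^ (- (1 + gamma)) * `|Q eps w t|) =
      (2 * lam < `|Q eps w t|).
    rewrite powRN mulrC ltr_pdivlMr// /lam; congr (_ < _).
    by rewrite -/E; field.
  by apply/seteqP; split => w [t [tT]]; [rewrite H|rewrite -H] => ?; exists t.
apply: (le_trans (qcov_sup_tail bmW T0 lam0 eps0 (ltW L0) mf lL lG _ Llam _ _ _)).
- exact: measurable_funB.
- by move=> t tT; have [] := HQ eps eps0 t tT.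
- by move=> t tT; have [] := HQ eps eps0 t tT.
- by move=> w; exact: cQ.
rewrite lee_fin.
(* The computation gives the rate with [gamma]; as [eps < 1] and [gamma < mu], the stated rate with
   [mu] is weaker. *)
apply: (@le_trans _ _ (D * eps `^ (2 * (alpha - gamma) / (1 - alpha)))); last first.
  rewrite ler_pM2l// ger_powR ?eps0 ?(ltW eps1)//.
  by rewrite ler_pM2r ?invr_gt0// ler_pM2l// lerB// ltW.
have hG : h `^ alpha = K `^ alpha * eps `^ (alpha * (1 - gamma) / (1 - alpha)).
  rewrite /h powRM ?(ltW K0) ?(ltW y0)//; congr (_ * _).
  by rewrite /y -powRrM; congr (_ `^ _); ring.
(* Multiplied by [1 - alpha], both exponents become [2 - 2 * alpha * gamma]. *)
have expo : eps ^+ 2 * (eps `^ (alpha * (1 - gamma) / (1 - alpha))) ^+ 2 =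
    eps `^ (2 * (alpha - gamma) / (1 - alpha)) * E ^+ 2.
  have sqr_eps x : (eps `^ x) ^+ 2 = eps `^ (x * 2).
    by rewrite -powR_mulrn ?powR_ge0// -powRrM.
  have -> : eps ^+ 2 = eps `^ 2 by rewrite -powR_mulrn// ltW.
  rewrite !sqr_eps -!powRD ?epsn0 ?implybT//.
  by congr (_ `^ _); field; rewrite gt_eqF.
rewrite le_eqVlt; apply/orP; left; apply/eqP.
rewrite hG /lam /D.
set x := eps `^ (alpha * _ / _) in expo *; set z := eps `^ (2 * _ / _) in expo *.
have -> : 2304 * T * eps ^+ 2 * (C * (K `^ alpha * x)) ^+ 2 =
    2304 * T * (C * K `^ alpha) ^+ 2 * (eps ^+ 2 * x ^+ 2) by ring.
rewrite expo; field.
by rewrite !gt_eqF.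
Qed.
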